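(* Let $\Lambda_{Leb}$ be the space of $C^1$ orientation-preserving uniformly expanding maps $f:S^1\to S^1$ of degree $2$ which preserve Lebesgue measure $\lambda$ (i.e. $f_*\lambda=\lambda$), endowed with the $C^1$-topology. Let $T^2=S^1\times S^1$, let $\mathrm{diag}(T^2)=\{(x,x):x\in S^1\}$, and let $D_+(S^1,\,0\text{ is fixed})$ be the group of orientation-preserving $C^1$ diffeomorphisms of $S^1$ fixing the point $0$, endowed with the $C^1$-topology. Then $\Lambda_{Leb}$ is homeomorphic to $$\bigl(T^2\setminus \mathrm{diag}(T^2)\bigr)\times D_+(S^1,\,0\text{ is fixed}).$$ In particular, $\Lambda_{Leb}$ is arc-connected and $\pi_1(\Lambda_{Leb})\cong\mathbb{Z}$.
   Context: The circle $S^1$ is the quotient $[0,1]/(0\sim 1)$, and $\lambda$ denotes Lebesgue measure on it. An orientation-preserving $C^1$ circle map $f$ is uniformly expanding if $f'(x)>1$ for all $x\in S^1$ (equivalently, by compactness, $f'\ge c$ for some constant $c>1$). The measure $f_*\lambda$ is the push-forward, $f_*\lambda(A)=\lambda(f^{-1}(A))$ for Borel sets $A$. The $C^1$-topology is the topology of uniform convergence of maps together with their first derivatives. *)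

(* Defs.v *)
From HB Require Import structures.
From mathcomp Require Import all_boot all_order all_algebra.
From mathcomp Require Import generic_quotient.
From mathcomp Require Import all_classical all_reals all_analysis.
From mathcomp Require Import measurable_realfun homotopy lra.
Set Implicit Arguments.
Unset Strict Implicit.
Unset Printing Implicit Defensive.
Import Order.TTheory GRing.Theory Num.Theory.
Import numFieldNormedType.Exports.
Local Open Scope classical_set_scope.
Local Open Scope ring_scope.
Local Open Scope quotient_scope.

Definition homeomorphic (X Y : topologicalType) : Prop :=
  exists (h : X -> Y) (k : Y -> X),
    [/\ cancel h k, cancel k h, continuous h & continuous k].

Definition topological_embedding (X Y : topologicalType) (f : X -> Y) : Prop :=
  injective f /\
  forall U : set X, open U <-> exists2 V : set Y, open V & U = f @^-1` V.

Section continuity.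
Variables (X Y Z : topologicalType).

Lemma continuous_compf (f : X -> Y) (g : Y -> Z) :
  continuous f -> continuous g -> continuous (fun x => g (f x)).
Proof. by move=> cf cg x; apply: continuous_comp; [exact: cf|exact: cg]. Qed.

Lemma continuous_pairf (f : X -> Y) (g : X -> Z) :
  continuous f -> continuous g -> continuous (fun x => (f x, g x)).
Proof. by move=> cf cg x; apply: cvg_pair; [exact: cf|exact: cg]. Qed.

Lemma continuous_fst : continuous (@fst X Y).
Proof. by move=> x; exact: cvg_fst. Qed.

Lemma continuous_snd : continuous (@snd X Y).
Proof. by move=> x; exact: cvg_snd. Qed.

End continuity.

Section pasting.
Variables (R : realType) (Z X : topologicalType) (phi : Z -> R) (c : R).
Variables (a b : Z -> X).
Hypotheses (cphi : continuous phi) (ca : continuous a) (cb : continuous b).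
Hypothesis ab : forall z, phi z = c -> a z = b z.

Lemma continuous_paste : continuous (fun z => if phi z <= c then a z else b z).
Proof.
set f := fun z => _.
pose A := [set z | phi z <= c]; pose B := [set z | c <= phi z].
have cA : closed A.
  apply: (@preimage_closed _ _ phi [set x | x <= c]).
    by move=> *; exact: cphi.
  exact: closed_le.
have cB : closed B.
  apply: (@preimage_closed _ _ phi [set x | c <= x]).
    by move=> *; exact: cphi.
  exact: closed_ge.
have AB : A `|` B = setT.
  apply/seteqP; split=> // z _; rewrite /A /B /=.
  by case: (leP (phi z) c) => [|/ltW]; [left|right].
apply/continuous_subspace_setT; rewrite -AB; apply: withinU_continuous => //.
- apply: (@subspace_eq_continuous Z A X a f).
    by move=> z; rewrite inE /A /f /= => ->.
  exact: continuous_subspaceT.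
- apply: (@subspace_eq_continuous Z B X b f).
    move=> z; rewrite inE /B /f /= => cz; case: ifPn => // zc.
    by rewrite ab//; apply/eqP; rewrite eq_le zc.
  exact: continuous_subspaceT.
Qed.

End pasting.

Definition I01 (R : realType) : Type := set_type `[0%R, 1%R : R]%classic.

Section unit_interval.
Variable R : realType.

HB.instance Definition _ := Topological.on (I01 R).
HB.instance Definition _ := SubType.on (I01 R).

Definition clamp (t : R) : R := Num.max 0 (Num.min 1 t).

Lemma clamp01 t : clamp t \in `[0%R, 1%R : R]%classic.
Proof.
rewrite inE /= in_itv /= /clamp le_max lexx /= ge_max ler01 /=.
by rewrite ge_min lexx.
Qed.

Definition clampI (t : R) : I01 R := exist _ (clamp t) (clamp01 t).

Lemma clamp_id t : 0 <= t <= 1 -> clamp t = t.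
Proof. by case/andP=> t0 t1; rewrite /clamp min_r// max_r. Qed.

Lemma I01_bounds (x : I01 R) : 0 <= \val x <= 1.
Proof. by case: x => x /=; rewrite inE /= in_itv. Qed.

Lemma clampIK (x : I01 R) : clampI (\val x) = x.
Proof. by apply: val_inj; rewrite /= clamp_id// I01_bounds. Qed.

Lemma continuous_valI : continuous (\val : I01 R -> R).
Proof. exact: initial_continuous. Qed.

Lemma continuous_clamp : continuous clamp.
Proof.
move=> t; apply: (@continuous_max R R (cst 0) (cst 1 \min id) t).
  exact: cst_continuous.
by apply: (@continuous_min R R (cst 1) id t) => //; exact: cst_continuous.
Qed.

Lemma continuous_clampI : continuous clampI.
Proof. by apply: continuous_comp_initial; exact: continuous_clamp. Qed.

Lemma I01_neq : clampI 0 != clampI 1.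
Proof.
by rewrite -val_eqE /= !clamp_id ?ler01 ?lexx// eq_sym oner_neq0.
Qed.

HB.instance Definition _ := isBiPointed.Build (I01 R) I01_neq.

Lemma val_zeroI : \val (zero : I01 R) = 0.
Proof. by rewrite /= clamp_id// lexx ler01. Qed.

Lemma val_oneI : \val (one : I01 R) = 1.
Proof. by rewrite /= clamp_id// lexx ler01. Qed.

End unit_interval.

Section fundamental_group.
Variables (R : realType) (X : topologicalType).
Local Notation I := (I01 R).

(* Homotopy relative to the endpoints. *)
Definition path_homotopic (x y : X) (p q : {path I from x to y in X}) : Prop :=
  exists H : I * I -> X,
    [/\ continuous H, forall s, H (s, zero) = p s, forall s, H (s, one) = q s,
        forall t, H (zero, t) = x & forall t, H (one, t) = y].

Lemma path_homotopic_refl x y (p : {path I from x to y in X}) :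
  path_homotopic p p.
Proof.
exists (p \o fst); split=> [z|s|s|t|t] //=; rewrite ?path_zero ?path_one//.
by apply: continuous_comp; [exact: cvg_fst|exact: cts_fun].
Qed.

Lemma continuous_affI (a b : R) :
  continuous (fun t : I => clampI (a * \val t + b)).
Proof.
move=> t; apply: (@continuous_comp _ _ _ (fun t : I => a * \val t + b)).
  apply: (@continuous_comp I R R (\val : I -> R) (fun s => a * s + b) t).
    exact: continuous_valI.
  apply: (@continuousD R R R ( *%R a) (cst b)); first exact: mulrl_continuous.
  exact: cst_continuous.
exact: continuous_clampI.
Qed.

Lemma continuous_flip : continuous (fun t : I => clampI (1 - \val t)).
Proof.
rewrite (_ : (fun _ => _) = fun t : I => clampI (- 1 * \val t + 1)).
  exact: continuous_affI.
by apply/funext => t; rewrite mulN1r addrC.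
Qed.

Lemma path_homotopic_sym x y (p q : {path I from x to y in X}) :
  path_homotopic p q -> path_homotopic q p.
Proof.
case=> H [cH H0 H1 Hx Hy].
exists (fun z => H (z.1, clampI (1 - \val z.2))); split=> [z|s|s|t|t] /=.
- apply: continuous_compf cH z; apply: continuous_pairf.
    exact: continuous_fst.
  exact: continuous_compf (@continuous_snd _ _) continuous_flip.
- by rewrite -H1 clamp_id ?subr0 ?lexx ?ler01.
- by rewrite -H0 clamp_id ?subrr ?lexx ?ler01.
- exact: Hx.
- exact: Hy.
Qed.

Lemma continuous_dbl : continuous (fun t : I => clampI (2 * \val t)).
Proof.
rewrite (_ : (fun _ => _) = fun t : I => clampI (2 * \val t + 0)).
  exact: continuous_affI.
by apply/funext => t; rewrite addr0.
Qed.

Lemma continuous_dbl1 : continuous (fun t : I => clampI (2 * \val t - 1)).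
Proof. exact: continuous_affI. Qed.

Let half0 : (0 <= 2^-1 :> R) = true. Proof. by rewrite invr_ge0 ler0n. Qed.

Let half1 : (1 <= 2^-1 :> R) = false.
Proof. by apply/negbTE; rewrite -ltNge; lra. Qed.

Let dbl1B : 2 * 1 - 1 = 1 :> R. Proof. lra. Qed.

Lemma dbl_half (t : I) : \val t = 2^-1 ->
  (clampI (2 * \val t) = one :> I) * (clampI (2 * \val t - 1) = zero :> I).
Proof.
by move=> ->; rewrite divff ?pnatr_eq0// subrr.
Qed.

Lemma path_homotopic_trans x y (p q r : {path I from x to y in X}) :
  path_homotopic p q -> path_homotopic q r -> path_homotopic p r.
Proof.
case=> H [cH H0 H1 Hx Hy] [K [cK K0 K1 Kx Ky]].
exists (fun z => if \val z.2 <= 2^-1 then H (z.1, clampI (2 * \val z.2))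
                 else K (z.1, clampI (2 * \val z.2 - 1))).
split=> [|s|s|t|t].
- apply: continuous_paste => [|||[s t] /= th].
  + exact: continuous_compf (@continuous_snd _ _) (@continuous_valI R).
  + apply: continuous_compf cH; apply: continuous_pairf.
      exact: continuous_fst.
    exact: continuous_compf (@continuous_snd _ _) continuous_dbl.
  + apply: continuous_compf cK; apply: continuous_pairf.
      exact: continuous_fst.
    exact: continuous_compf (@continuous_snd _ _) continuous_dbl1.
  + by rewrite !dbl_half// H1 K0.
- by rewrite -H0 !val_zeroI half0 mulr0.
- by rewrite -K1 !val_oneI half1 dbl1B.
- by rewrite Hx Kx if_same.
- by rewrite Hy Ky if_same.
Qed.

Definition path_mul (x y z : X) (p : {path I from x to y in X})
    (q : {path I from y to z in X}) : I -> X :=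
  fun s => if \val s <= 2^-1 then p (clampI (2 * \val s))
           else q (clampI (2 * \val s - 1)).

Section path_mul.
Variables (x y z : X) (p : {path I from x to y in X}).
Variable (q : {path I from y to z in X}).

Lemma path_mul_continuous : continuous (path_mul p q).
Proof.
apply: continuous_paste => [|||s sh].
- exact: continuous_valI.
- exact: continuous_compf continuous_dbl cts_fun.
- exact: continuous_compf continuous_dbl1 cts_fun.
- by rewrite !dbl_half// path_zero path_one.
Qed.

Lemma path_mul_zero : path_mul p q zero = x.
Proof.
rewrite /path_mul val_zeroI half0 mulr0; exact: path_zero.
Qed.

Lemma path_mul_one : path_mul p q one = z.
Proof.
rewrite /path_mul val_oneI half1 dbl1B.
exact: path_one.
Qed.

HB.instance Definition _ := isContinuous.Build I X (path_mul p q)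
  path_mul_continuous.
HB.instance Definition _ := isPath.Build I X x z (path_mul p q)
  path_mul_zero path_mul_one.

End path_mul.

Lemma path_homotopic_mul x y z (p p' : {path I from x to y in X})
    (q q' : {path I from y to z in X}) :
  path_homotopic p p' -> path_homotopic q q' ->
  path_homotopic (path_mul p q) (path_mul p' q').
Proof.
case=> H [cH H0 H1 Hx Hy] [K [cK K0 K1 Kx Ky]].
exists (fun z => if \val z.1 <= 2^-1 then H (clampI (2 * \val z.1), z.2)
                 else K (clampI (2 * \val z.1 - 1), z.2)).
split=> [|s|s|t|t].
- apply: continuous_paste => [|||[s t] /= th].
  + exact: continuous_compf (@continuous_fst _ _) (@continuous_valI R).
  + apply: continuous_compf cH; apply: continuous_pairf.
      exact: continuous_compf (@continuous_fst _ _) continuous_dbl.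
    exact: continuous_snd.
  + apply: continuous_compf cK; apply: continuous_pairf.
      exact: continuous_compf (@continuous_fst _ _) continuous_dbl1.
    exact: continuous_snd.
  + by rewrite !dbl_half// Hy Kx.
- by rewrite /path_mul H0 K0.
- by rewrite /path_mul H1 K1.
- by rewrite -[RHS](Hx t) val_zeroI half0 mulr0.
- by rewrite -[RHS](Ky t) val_oneI half1 dbl1B.
Qed.

Section pi1.
Variable x : X.
Local Notation loop := {path I from x to x in X}.

Definition loop_rel (p q : loop) : bool := `[< path_homotopic p q >].

Lemma loop_rel_refl : reflexive loop_rel.
Proof. by move=> p; apply/asboolP; exact: path_homotopic_refl. Qed.

Lemma loop_rel_sym : symmetric loop_rel.
Proof.
by move=> p q; apply/asbool_equiv_eq; split; exact: path_homotopic_sym.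
Qed.

Lemma loop_rel_trans : transitive loop_rel.
Proof.
move=> q p r /asboolP pq /asboolP qr; apply/asboolP.
exact: path_homotopic_trans pq qr.
Qed.

Definition loop_equiv := EquivRel _ loop_rel_refl loop_rel_sym loop_rel_trans.

Definition pi1 := {eq_quot loop_equiv}.

Definition pi1_mul (a b : pi1) : pi1 :=
  \pi_pi1 (path_mul (repr a) (repr b) : loop).

Lemma pi1_mulE (p q : loop) :
  pi1_mul (\pi_pi1 p) (\pi_pi1 q) = \pi_pi1 (path_mul p q : loop).
Proof.
apply/eqmodP/asboolP; apply: path_homotopic_mul; apply/asboolP.
- by apply/(@eqmodP _ loop_equiv); rewrite reprK.
- by apply/(@eqmodP _ loop_equiv); rewrite reprK.
Qed.

End pi1.
End fundamental_group.
Section circle.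
Variable R : realType.
Local Notation I := (I01 R).

(* The circle is [0, 1] with its endpoints identified. *)
Definition circle_rel (x y : I) : bool :=
  (x == y) || ((x \in [:: zero; one]) && (y \in [:: zero; one])).

Lemma circle_rel_refl : reflexive circle_rel.
Proof. by move=> x; rewrite /circle_rel eqxx. Qed.

Lemma circle_rel_sym : symmetric circle_rel.
Proof. by move=> x y; rewrite /circle_rel eq_sym andbC. Qed.

Lemma circle_rel_trans : transitive circle_rel.
Proof.
move=> y x z; rewrite /circle_rel => /predU1P[->//|/andP[x01 y01]].
by move=> /predU1P[<-|/andP[_ z01]]; rewrite x01 ?y01 ?z01 orbT.
Qed.

Definition circle_equiv :=
  EquivRel _ circle_rel_refl circle_rel_sym circle_rel_trans.

Definition circle := {eq_quot circle_equiv}.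

HB.instance Definition _ := Topological.copy circle (quotient_topology circle).
HB.instance Definition _ := Quotient.on circle.

(* The universal covering t |-> t mod 1. *)
Definition ang (t : R) : circle :=
  \pi_circle (clampI (t - (Num.floor t)%:~R)).

Lemma circle_zero_one : \pi_circle (zero : I) = \pi_circle (one : I).
Proof.
by apply/eqmodP; rewrite /= /circle_rel !inE !eqxx !orbT.
Qed.

Lemma frac_bounds (t : R) : 0 <= t - (Num.floor t)%:~R < 1.
Proof.
by rewrite subr_ge0 floor_le_tmp ltrBlDl -intrD1 floorD1_gt.
Qed.

Lemma angD (t : R) (n : int) : ang (t + n%:~R) = ang t.
Proof.
congr (\pi_circle (clampI _)).
by rewrite floorDrz ?intr_int// intrKfloor intrD opprD addrACA subrr addr0.
Qed.

Lemma ang_val (x : I) : ang (\val x) = \pi_circle x.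
Proof.
have /andP[x0] := I01_bounds x; rewrite le_eqVlt => /predU1P[x1|x1].
  have -> : x = one by apply: val_inj; rewrite x1 val_oneI.
  rewrite -circle_zero_one val_oneI.
  by rewrite /ang floor1 subrr.
rewrite /ang (_ : Num.floor _ = 0) ?subr0 ?clampIK//.
by apply: floor_def; rewrite x0 x1.
Qed.

Lemma ang_surj (x : circle) : exists t, ang t = x.
Proof. by exists (\val (repr x)); rewrite ang_val reprK. Qed.

Lemma ang_eq (s t : R) : ang s = ang t -> exists n : int, t = s + n%:~R.
Proof.
set s' := s - (Num.floor s)%:~R; set t' := t - (Num.floor t)%:~R.
have /andP[s0 s1] : 0 <= s' < 1 := frac_bounds s.
have /andP[t0 t1] : 0 <= t' < 1 := frac_bounds t.
have vs : \val (clampI s') = s' by rewrite /= clamp_id// s0 ltW.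
have vt : \val (clampI t') = t' by rewrite /= clamp_id// t0 ltW.
have z01 u : clampI u \in [:: zero; one : I] -> \val (clampI u) < 1 ->
    \val (clampI u) = 0.
  rewrite !inE => /orP[] /eqP ->; first by rewrite val_zeroI.
  by rewrite val_oneI ltxx.
move=> /eqmodP h.
have {h} : s' = t'.
  have {h} : circle_rel (clampI s') (clampI t') by [].
  rewrite /circle_rel => /predU1P[h|/andP[hs ht]].
    by rewrite -vs -vt h.
  rewrite -vs in s1; rewrite -vt in t1.
  by have := z01 _ hs s1; have := z01 _ ht t1; rewrite vs vt => -> ->.
rewrite /s' /t' => h; exists (Num.floor t - Num.floor s).
by rewrite intrB; lra.
Qed.

Lemma ang_continuous : continuous ang.
Proof.
pose c (m : int) (u : R) : circle := \pi_circle (clampI (u - m%:~R)).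
have cpi : continuous (\pi_circle : I -> circle) by exact: pi_continuous.
have cc m : continuous (c m).
  have cB : continuous (fun u : R => u - m%:~R).
    move=> u; apply: (@continuousB R R R id (cst _)) => //.
    exact: cst_continuous.
  exact: continuous_compf (continuous_compf cB (@continuous_clampI R)) cpi.
move=> t U Ut; set n := Num.floor t.
change (\forall u \near t, U (ang u)).
have /andP[t0 t1] := frac_bounds t; rewrite -/n in t0 t1.
have cn : \forall u \near t, U (c n u) by exact: cc.
have cn1 : t = n%:~R -> \forall u \near t, U (c (n - 1) u).
  move=> tn; apply: (cc (n - 1) t).
  suff -> : c (n - 1) t = ang t by [].
  rewrite /c /ang -/n intrB tn subrr opprB addrC subrK.
  exact/esym/circle_zero_one.
have ltn : \forall u \near t, u < n%:~R + 1.
  by apply: lt_nbhsl; lra.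
have [tn|tn] := eqVneq t n%:~R.
  near=> u.
  have un : u < n%:~R + 1 by near: u.
  have nu : n%:~R - 1 < u.
    by near: u; apply: lt_nbhsr; lra.
  have [lnu|lun] := leP n%:~R u.
    have := near cn u; rewrite /c /ang (_ : Num.floor u = n); first by apply.
    by apply: floor_def; rewrite lnu intrD.
  have := near (cn1 tn) u.
  rewrite /c /ang (_ : Num.floor u = n - 1); first by apply.
  by apply: floor_def; rewrite subrK lun intrB ltW.
near=> u.
have := near cn u; rewrite /c /ang (_ : Num.floor u = n); first by apply.
apply: floor_def; rewrite intrD; apply/andP; split; last by near: u.
apply/ltW; near: u; apply: lt_nbhsr.
by rewrite lt_neqAle eq_sym tn; lra.
Unshelve. all: by end_near. Qed.

(* The metric induced by |s - t| on R; [circle_nbhsE] shows that it metrizes the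
   quotient topology. *)
Definition circle_ball (x : circle) (e : R) (y : circle) : Prop :=
  exists s t : R, [/\ ang s = x, ang t = y & `|s - t| < e].

Lemma circle_ball_center x (e : R) : 0 < e -> circle_ball x e x.
Proof.
by have [t <-] := ang_surj x; exists t, t; rewrite subrr normr0.
Qed.

Lemma circle_ball_sym x y e : circle_ball x e y -> circle_ball y e x.
Proof. by case=> s [t [sx ty st]]; exists t, s; rewrite distrC. Qed.

Lemma circle_ball_triangle x y z e1 e2 :
  circle_ball x e1 y -> circle_ball y e2 z -> circle_ball x (e1 + e2) z.
Proof.
case=> s [t [sx ty st]] [s' [t' [sy tz st']]].
have [n tE] : exists n : int, t = s' + n%:~R by apply: ang_eq; rewrite sy ty.
exists s, (t' + n%:~R); split=> //; first by rewrite angD.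
rewrite (_ : s - _ = (s - t) + (s' - t')); last by rewrite tE; lra.
by rewrite (le_lt_trans (ler_normD _ _))// ltrD.
Qed.

Lemma circle_nbhsE : nbhs = nbhs_ (entourage_ circle_ball) :> (circle -> _).
Proof.
apply/funext => x; apply/seteqP; split => U.
  have [s <-] := ang_surj x.
  move=> /ang_continuous /nbhs_ballP[e /= e0 sU].
  exists [set xy | circle_ball xy.1 e xy.2]; first by exists e.
  move=> y /xsectionP /= [s' [t' [ss ty st]]].
  have [n sE] : exists n : int, s = s' + n%:~R by exact: ang_eq.
  rewrite -ty -(angD t' n); apply: sU.
  by rewrite /ball /= sE opprD addrACA subrr addr0.
case=> A [e /= e0 eA] AU.
have {AU} : circle_ball x e `<=` U.
  by move=> y xy; apply: AU; apply/xsectionP/eA.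
move=> /filterS; apply; rewrite nbhsE.
exists (circle_ball x e) => //; split; last exact: circle_ball_center.
rewrite /open /= /quotient_open openE => y /= [s [t [sx ty st]]].
have d0 : 0 < e - `|s - t| by rewrite subr_gt0.
have vN : nbhs y (\val @^-1` ball (\val y) (e - `|s - t|)).
  exact: (@continuous_valI R y _ (nbhsx_ballx (\val y) _ d0)).
apply: (filterS _ vN) => z; rewrite /ball /= => yz.
have [n tE] : exists n : int, t = \val y + n%:~R.
  by apply: ang_eq; rewrite ang_val ty.
exists s, (\val z + n%:~R); split=> //; first by rewrite angD ang_val.
rewrite (_ : _ - _ = (s - t) + (\val y - \val z)); last by rewrite tE; lra.
by rewrite (le_lt_trans (ler_normD _ _))// -ltrBrDl.
Qed.

HB.instance Definition _ := Nbhs_isPseudoMetric.Build R circle circle_nbhsE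
  circle_ball_center circle_ball_sym circle_ball_triangle erefl.
HB.instance Definition _ := Uniform_isPseudoMetric.Build R circle
  circle_ball_center circle_ball_sym circle_ball_triangle erefl.

End circle.

Section circle_maps.
Variable R : realType.
Local Notation circle := (circle R).

HB.instance Definition _ := isPointed.Build circle (ang 0).

Definition circle_borel : Type :=
  g_sigma_algebraType (open : set (set circle)).
HB.instance Definition _ := Measurable.on circle_borel.

Lemma measurable_ang :
  measurable_fun [set: measurableTypeR R]
    (@ang R : measurableTypeR R -> circle_borel).
Proof.
refine (@measurability _ _ (measurableTypeR R) circle_borel setT (@ang R)
  (open : set (set circle)) _ _) => //.
move=> _ [U oU <-]; rewrite setTI; apply: open_measurable.
have /continuousP := @ang_continuous R; exact.
Qed.

Definition circle_lebesgue : set circle_borel -> \bar R :=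
  pushforward (mrestr (@lebesgue_measure R) (measurable_itv `[0%R, 1%R : R]))
    (@ang R : measurableTypeR R -> circle_borel).

Let circle_lebesgue0 : circle_lebesgue set0 = 0%E.
Proof. by rewrite /circle_lebesgue /pushforward preimage_set0 measure0. Qed.

Let circle_lebesgue_ge0 A : (0 <= circle_lebesgue A)%E.
Proof. by rewrite /circle_lebesgue /pushforward; apply: measure_ge0. Qed.

Let circle_lebesgue_sigma_additive : semi_sigma_additive circle_lebesgue.
Proof.
have mang A : measurable A -> measurable ((@ang R : _ -> circle_borel) @^-1` A).
  by move=> mA; rewrite -[X in measurable X]setTI; exact: measurable_ang.
move=> F mF tF mUF; rewrite /circle_lebesgue /pushforward preimage_bigcup.
apply: measure_semi_sigma_additive.
- by move=> n; exact: mang.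
- apply/trivIsetP => i j _ _ ij; rewrite -preimage_setI.
  by move/trivIsetP : tF => /(_ _ _ _ _ ij) ->//; rewrite preimage_set0.
- by rewrite -preimage_bigcup; exact: mang.
Qed.

HB.instance Definition _ := isMeasure.Build _ _ _ circle_lebesgue
  circle_lebesgue0 circle_lebesgue_ge0 circle_lebesgue_sigma_additive.

(* [f] has derivative [l] at [x] when it does in the local charts inverse to
   [ang]: near a preimage [s] of [x], [f \o ang] is [ang \o F], F'(s) = [l]. *)
Definition is_circle_derive (f : circle -> circle) (x : circle) (l : R) :
    Prop :=
  exists (s : R) (F : R -> R),
    [/\ ang s = x, \forall t \near s, f (ang t) = ang (F t)
      & is_derive s 1 F l].

Definition circle_derive (f : circle -> circle) (x : circle) : R :=
  xget 0 (is_circle_derive f x).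

Definition circle_C1 (f : circle -> circle) : Prop :=
  (forall x, exists l, is_circle_derive f x l) /\ continuous (circle_derive f).

Record C1map := MkC1map {
  C1_fun :> circle -> circle;
  C1_funP : circle_C1 C1_fun
}.

HB.instance Definition _ := gen_eqMixin C1map.
HB.instance Definition _ := gen_choiceMixin C1map.

(* The C1 topology is the topology of uniform convergence of f and f'. *)
Definition C1_jet (f : C1map) :
    {uniform circle -> circle} * {uniform circle -> R} :=
  (f : circle -> circle, circle_derive f).

HB.instance Definition _ := Topological.copy C1map (initial_topology C1_jet).

Definition orientation_preserving (f : C1map) : Prop :=
  forall x, 0 < circle_derive f x.

Definition uniformly_expanding (f : C1map) : Prop :=
  forall x, 1 < circle_derive f x.

(* A map of degree d has a continuous lift F with F (t + 1) = F t + d. *)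
Definition has_degree (f : circle -> circle) (d : int) : Prop :=
  exists F : R -> R,
    [/\ continuous F, forall t, f (ang t) = ang (F t)
      & forall t, F (t + 1) = F t + d%:~R].

Definition preserves_lebesgue (f : circle -> circle) : Prop :=
  forall A : set circle_borel, measurable A ->
    pushforward circle_lebesgue (f : circle_borel -> circle_borel) A =
    circle_lebesgue A.

(* The inverse is again a C1 map, since [g] has type [C1map]. *)
Definition C1_diffeomorphism (f : C1map) : Prop :=
  exists g : C1map, cancel f g /\ cancel g f.

Definition Lambda_Leb : set C1map :=
  [set f | [/\ orientation_preserving f, uniformly_expanding f,
               has_degree f 2 & preserves_lebesgue f]].

Definition Diff0 : set C1map :=
  [set f | [/\ C1_diffeomorphism f, orientation_preserving f
             & f (ang 0) = ang 0]].

Definition torus_minus_diag : set (circle * circle) := ~` diagonal.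

End circle_maps.

Arguments Lambda_Leb R : clear implicits.
Arguments Diff0 R : clear implicits.
Arguments torus_minus_diag R : clear implicits.

(* An arc is an embedded interval, so distinct endpoints are required. *)
Definition arc_connected (R : realType) (X : topologicalType) : Prop :=
  forall x y : X, x <> y ->
    exists p : {path (I01 R) from x to y in X},
      topological_embedding (p : I01 R -> X).

(* The group laws of [pi1 R x] need not be assumed: a multiplicative bijection
   onto the group (int, +) is a group isomorphism. *)
Definition pi1_iso_int (R : realType) (X : topologicalType) (x : X) : Prop :=
  exists phi : pi1 R x -> int,
    bijective phi /\ {morph phi : a b / pi1_mul a b >-> a + b}.

(* Main.v *)
Require Import Defs.
From HB Require Import structures.
From mathcomp Require Import all_boot all_order all_algebra.
From mathcomp Require Import generic_quotient.
From mathcomp Require Import all_classical all_reals all_analysis.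
From mathcomp Require Import measurable_realfun homotopy ring lra.

(** Both spaces are homeomorphic to [circle * E], where [E] is the space of
    continuous functions [u : R -> R] such that [u (t + 1) = - u t], with the
    topology of uniform convergence.

    For an expanding map [f], take the fixed point [p] and the lift [F] with
    [F p = p].  The inverse [G] of [F] satisfies [G (t + 2) = G t + 1], and [f]
    preserves the Lebesgue measure iff [G t + G (t + 1) - t] is constant, i.e.
    [G' t + G' (t + 1) = 1].  Writing [G' (p + t) = 1 / (1 + exp (- u t))], this
    says that [u] is in [E]; conversely [p] mod 1 and [u] determine [f].

    A pair of distinct points of the circle is a point and a gap in ]0, 1[, that
    is, a point and a real number [a].  A diffeomorphism fixing 0 is given by its
    logarithmic derivative normalized at 0, a continuous 1-periodic function [v]
    with [v 0 = 0].  Changing the sign of [v] on every other unit interval makes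
    it antiperiodic, and [u t = a cos (pi t) + (-1)^(floor t) v t] runs over [E].

    Finally [E] is convex, so the arcs and the loops of [circle * E] are
    those of the circle, up to straight-line homotopies. *)

Set Implicit Arguments.
Unset Strict Implicit.
Unset Printing Implicit Defensive.
Import Order.TTheory GRing.Theory Num.Theory.
Import numFieldNormedType.Exports.
Local Open Scope classical_set_scope.
Local Open Scope ring_scope.

(** * Real functions *)

(** The inverse [G] is parametrized rather than [f] because the derivative of [f] at a point is
    [1 + exp (- u)] read at the image of that point, so [u] describes [f] only implicitly, whereas
    [G] is a plain primitive of the logistic function of [u]. Estimates on expanding maps therefore
    pass through inverses and return by Lipschitz or expansion bounds on the lift. The fixed point
    is a canonical origin: the lift minus the identity has positive derivative and degree 1, so [f]
    has exactly one fixed point. On the other side, normalizing the logarithmic derivative at 0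
    loses nothing, because a lift of a diffeomorphism gains exactly 1 over a period, which fixes the
    missing constant. Lifts, and fixed points on the line, are determined only up to integers. Both
    correspondences are therefore relations, total on each side and continuous in each direction,
    rather than explicit functions. *)

Section real_functions.
Variable R : realType.
Implicit Types (f g F G D : R -> R) (x y t e : R).

Lemma is_derive1_cont f x l : is_derive x 1 f l -> {for x, continuous f}.
Proof.
by move=> [df _]; apply/differentiable_continuous/derivable1_diffP.
Qed.

Lemma continuousR_lt f x e : {for x, continuous f} -> 0 < e ->
  exists2 d : R, 0 < d & forall y, `|x - y| < d -> `|f x - f y| < e.
Proof.
move=> cf e0; have /cvgrPdist_lt /(_ e e0) /nbhs_ballP [d d0 h] := cf.
by exists d => // y xy; exact: h.
Qed.

Lemma near_dist (x : R) (P : R -> Prop) :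
  (\forall y \near x, P y) <->
  exists2 d : R, 0 < d & forall y, `|x - y| < d -> P y.
Proof.
split=> [/nbhs_ballP[d d0 h]|[d d0 h]]; first by exists d.
by apply/nbhs_ballP; exists d.
Qed.

Lemma near_norm_lt (x c : R) : `|x| < c -> \forall y \near x, `|y| < c.
Proof.
move=> xc; apply/near_dist; exists (c - `|x|); first by rewrite subr_gt0.
move=> y xy; rewrite -(subrK x y) (le_lt_trans (ler_normD _ _))//.
by rewrite -ltrBrDr distrC.
Qed.

Lemma near_eq_continuous (T : topologicalType) (f g : R -> T) (x : R) :
  (\forall y \near x, f y = g y) -> {for x, continuous f} ->
  {for x, continuous g}.
Proof.
move=> fg; rewrite /prop_for /continuous_at -(nbhs_singleton fg).
by apply: cvg_trans; apply: near_eq_cvg; apply: filterS fg.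
Qed.

(** Only [x] is confined to the segment. [periodic_unif_cont] relies on this: translating [x] into
    one period gives no control on where [y] lands. *)
Lemma segment_unif_cont (V : pseudoMetricType R) (f : R -> V) (a b e : R) :
  continuous f -> 0 < e ->
  exists2 d : R, 0 < d &
    forall x y, a <= x <= b -> `|x - y| < d -> ball (f x) e (f y).
Proof.
move=> cf e0.
have /compact_near_coveringP cab := @segment_compact R a b.
have := cab R (0 : R)^'+
  (fun d x => forall y, `|x - y| < d -> ball (f x) e (f y)) _.
case.
  move=> x _.
  have [r r0 hr] : exists2 r : R, 0 < r & forall y, `|x - y| < r ->
      ball (f x) (e / 2) (f y).
    apply/near_dist; apply: cf; apply: nbhsx_ballx; exact: divr_gt0.
  exists (ball x (r / 2), [set d | d < r / 2]).
    split=> /=; first by apply: nbhsx_ballx; exact: divr_gt0.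
    by apply: nbhs_right_lt; exact: divr_gt0.
  move=> [x' d] /= [xx' dr] y x'y.
  apply: (@ball_splitr _ _ (f x)).
    by apply: hr; rewrite (lt_trans xx')// ltr_pdivrMr// ltr_pMr// ltr1n.
  apply: hr; rewrite (_ : x - y = (x - x') + (x' - y)); last by ring.
  rewrite (le_lt_trans (ler_normD _ _))// [r]splitr ltrD//.
  by rewrite (lt_trans x'y).
move=> d /= d0 hd; exists (d / 2); first exact: divr_gt0.
move=> x y xab xy; apply: (hd (d / 2)) => //=; last exact: divr_gt0.
by rewrite sub0r normrN gtr0_norm ?divr_gt0// ltr_pdivrMr// ltr_pMr// ltr1n.
Qed.

Lemma periodicz f (c : R) : (forall t, f (t + c) = f t) ->
  forall (n : int) t, f (t + n%:~R * c) = f t.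
Proof.
move=> fc; have fn (n : nat) t : f (t + n%:R * c) = f t.
  elim: n t => [|n IHn] t; first by rewrite mul0r addr0.
  by rewrite -natr1 mulrDl mul1r addrA fc.
case=> n t; first by rewrite -pmulrn fn.
by rewrite NegzE mulrNz -pmulrn mulNr -(fn n.+1 (t - _)) subrK.
Qed.

Lemma reduce_mod (c t : R) : 0 < c ->
  exists n : int, 0 <= t + n%:~R * c < c.
Proof.
move=> c0; exists (- Num.floor (t / c)).
have /andP[h1 h2] := frac_bounds (t / c).
rewrite mulrNz mulNr; apply/andP; split.
  by rewrite subr_ge0 -ler_pdivlMr// -subr_ge0.
by rewrite ltrBlDl -[X in _ < _ + X]mul1r -mulrDl -ltr_pdivrMr// addrC -ltrBlDr.
Qed.

Lemma periodic_unif_cont f (c e : R) : 0 < c -> (forall t, f (t + c) = f t) ->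
  continuous f -> 0 < e ->
  exists2 d : R, 0 < d & forall x y, `|x - y| < d -> `|f x - f y| < e.
Proof.
move=> c0 fc cf e0; have [d d0 hd] := segment_unif_cont 0 c cf e0.
exists d => // x y xy; have [n /andP[h1 h2]] := reduce_mod x c0.
rewrite -(periodicz fc n x) -(periodicz fc n y); apply: hd.
  by rewrite h1 ltW.
by rewrite opprD addrACA subrr addr0.
Qed.

Lemma periodic_max f (c : R) : 0 < c -> (forall t, f (t + c) = f t) ->
  continuous f -> exists x, forall y, f y <= f x.
Proof.
move=> c0 fc cf.
have [x _ hx] := EVT_max (ltW c0) (continuous_subspaceT cf).
exists x => y; have [n /andP[h1 h2]] := reduce_mod y c0.
by rewrite -(periodicz fc n y); apply: hx; rewrite in_itv /= h1 ltW.
Qed.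

Lemma periodic_bounded f (c : R) : 0 < c -> (forall t, f (t + c) = f t) ->
  continuous f -> exists2 B : R, 0 < B & forall y, `|f y| <= B.
Proof.
move=> c0 fc cf.
have [|x hx] := @periodic_max (fun y => `|f y|) c c0 (fun t => congr1 Num.norm (fc t)).
  by move=> y; apply: (continuous_comp (cf y)); exact: norm_continuous.
exists (`|f x| + 1); first by rewrite ltr_wpDl.
by move=> y; rewrite (le_trans (hx y))// lerDl.
Qed.

Lemma periodic_pos_lb f (c : R) : 0 < c -> (forall t, f (t + c) = f t) ->
  continuous f -> (forall t, 0 < f t) -> exists2 m : R, 0 < m & forall y, m <= f y.
Proof.
move=> c0 fc cf f0.
have [|x hx] := @periodic_max (fun y => - f y) c c0 (fun t => congr1 -%R (fc t)).
  by move=> y; apply: (@continuousN _ R^o); exact: cf.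
by exists (f x) => // y; rewrite -lerN2.
Qed.

Lemma MVT_line f D (a b : R) : (forall x, is_derive x 1 f (D x)) ->
  a <= b -> exists2 c, a <= c <= b & f b - f a = D c * (b - a).
Proof.
move=> fD ab; have [|c] := @MVT_segment R f D a b ab.
  apply: continuous_subspaceT => x; exact: is_derive1_cont (fD x).
by rewrite in_itv /=; exists c.
Qed.

Lemma MVT_exists f D (a b : R) : (forall x, is_derive x 1 f (D x)) ->
  exists c, f b - f a = D c * (b - a).
Proof.
move=> fD; have [ab|/ltW ba] := leP a b.
  by have [c _ h] := MVT_line fD ab; exists c.
have [c _ h] := MVT_line fD ba; exists c.
by rewrite -opprB h -mulrN opprB.
Qed.

Lemma deriv_gt0_lt f D : (forall x, is_derive x 1 f (D x)) ->
  (forall x, 0 < D x) -> {mono f : x y / x < y}.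
Proof.
move=> fD D0; apply: leW_mono; apply: le_mono => x y xy.
have [c _ h] := MVT_line fD (ltW xy).
by rewrite -subr_gt0 h mulr_gt0// subr_gt0.
Qed.

(** If the nearby integer changed between two points, [f] would cross a half-integer, which is at
    distance at least 1/2 from every integer. *)
Lemma near_integer_const f e : continuous f -> e <= 2^-1 ->
  (forall x, exists n : int, `|f x - n%:~R| < e) ->
  exists n : int, forall x, `|f x - n%:~R| < e.
Proof.
move=> cf e2 hf; have [n hn] := hf 0; exists n => x.
have [m hm] := hf x.
suff : m = n by move=> <-.
apply: contrapT => nm.
(* The half-integer just below the larger of the two integers lies between [f 0] and [f x]. *)
pose v : R := (Num.max m n)%:~R - 2^-1.
have [|||c _ fc] := @IVT R f (Num.min 0 x) (Num.max 0 x) v.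
- by rewrite ge_min le_max lexx.
- exact: continuous_subspaceT.
- have {nm} : (m < n) || (n < m) by case: ltgtP nm.
  have f12 a b (k l : int) : `|f a - k%:~R| < e -> `|f b - l%:~R| < e ->
      k < l -> f a <= l%:~R - 2^-1 <= f b.
    move=> ha hb kl; have kl' : k%:~R + 1 <= l%:~R :> R.
      by rewrite -(intrD _ k 1) ler_int lezD1.
    move: ha hb; rewrite !ltr_norml => /andP[_ ha] /andP[hb _].
    by apply/andP; split; lra.
  case/orP => h.
    have mx : Num.max m n = n by rewrite max_r// ltW.
    have /andP[h1 h2] := f12 _ _ _ _ hm hn h.
    rewrite /v mx; case: (leP 0 x) => _; rewrite ge_min le_max ?h1 ?h2 ?orbT//.
  have mx : Num.max m n = m by rewrite max_l// ltW.
  have /andP[h1 h2] := f12 _ _ _ _ hn hm h.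
  by rewrite /v mx; case: (leP 0 x) => _; rewrite ge_min le_max ?h1 ?h2 ?orbT.
have [k] := hf c; rewrite fc /v.
move: (Num.max m n) => l; rewrite ltr_norml => /andP[h1 h2].
have : (k < l)%R || (l <= k)%R by case: ltP.
case/orP.
  rewrite -lezD1 -(ler_int R) intrD => h; lra.
rewrite -(ler_int R) => h; lra.
Qed.

Lemma integer_valued_const f : continuous f ->
  (forall x, exists n : int, f x = n%:~R) -> forall x y, f x = f y.
Proof.
move=> cf hf.
have [|n hn] := near_integer_const cf (lexx _).
  by move=> x; have [m ->] := hf x; exists m; rewrite subrr normr0 invr_gt0.
suff h x : f x = n%:~R by move=> x y; rewrite !h.
have [m fm] := hf x; have := hn x; rewrite fm -intrB -intr_norm.
case: (m =P n) => [->//|/eqP mn]; move=> h; exfalso.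
have : (1 <= `|m - n|)%R by rewrite -gtz0_ge1 normr_gt0 subr_eq0.
rewrite -(ler_int R) => h1; have : (1 : R) < 2^-1 := le_lt_trans h1 h.
lra.
Qed.

End real_functions.

Section inverse_and_primitive.
Variable R : realType.
Implicit Types (f g F G D : R -> R) (x y t e : R).

Lemma quasiperiodicz F (c k : R) : c != 0 -> (forall t, F (t + c) = F t + k) ->
  forall (n : int) t, F (t + n%:~R * c) = F t + n%:~R * k.
Proof.
move=> c0 Fc n t.
(* Subtracting the linear function of slope [k / c] leaves a [c]-periodic function. *)
have := @periodicz R (fun t => F t - (k / c) * t) c _ n t.
have -> : k / c * (t + n%:~R * c) = k / c * t + n%:~R * k by field.
move=> h; apply/eqP; rewrite -subr_eq0; apply/eqP.
suff : F (t + n%:~R * c) - (k / c * t + n%:~R * k) - (F t - k / c * t) = 0.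
  by move=> <-; ring.
apply/eqP; rewrite subr_eq0; apply/eqP; apply: h => s.
by rewrite Fc; field.
Qed.

(** Serves for lifts of diffeomorphisms, for lifts of degree 2 and their inverses, and for finding
    the fixed point of an expanding map. Surjectivity reduces, by a translation, to values taken
    between 0 and [c]. *)
Lemma quasiperiodic_inverse F D (c k : R) : 0 < c -> 0 < k ->
  (forall x, is_derive x 1 F (D x)) -> (forall x, 0 < D x) ->
  (forall t, F (t + c) = F t + k) ->
  exists G, [/\ cancel F G, cancel G F,
    forall t, is_derive t 1 G (D (G t))^-1 & forall t, G (t + k) = G t + c].
Proof.
move=> c0 k0 FD D0 Fc.
have Finj : injective F.
  move=> x y Fxy; have Fm := deriv_gt0_lt FD D0.
  by case: (ltgtP x y) => //; rewrite -Fm Fxy ltxx.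
have surj y : exists x, F x = y.
  have [n /andP[h1 h2]] := reduce_mod (y - F 0) k0.
  have [|||x _ hx] := @IVT R F 0 c (y + n%:~R * k).
  - exact: ltW.
  - apply: continuous_subspaceT => x; exact: is_derive1_cont (FD x).
  - have -> : F c = F 0 + k by rewrite -Fc add0r.
    by rewrite ge_min le_max; apply/andP; split; apply/orP; [left|right]; lra.
  exists (x + (- n)%:~R * c); rewrite (quasiperiodicz _ Fc) ?gt_eqF// hx.
  by rewrite mulrNz; ring.
pose G y := xget 0 [set x | F x = y].
have GK : cancel G F by move=> y; apply: (xgetPex 0 (surj y)).
have FK : cancel F G by move=> x; apply: Finj; rewrite GK.
exists G; split=> // t.
  rewrite -{1}[t]GK; apply: is_derive_inverse => //; last by rewrite gt_eqF.
    by near=> z; exact: FK.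
  by near=> z; exact: is_derive1_cont (FD z).
by apply: Finj; rewrite GK Fc GK.
Unshelve. all: by end_near. Qed.

(** Each [P n] is trusted only on the interval of radius [n + 1]; both primitives and lifts are
    built on such growing intervals. *)
Lemma glue_nat (T : Type) (P : nat -> R -> T) :
  (forall n t, `|t| < n.+1%:R -> P n.+1 t = P n t) ->
  exists Q : R -> T, forall n t, `|t| < n.+1%:R -> Q t = P n t.
Proof.
move=> PS.
have Pm m n t : (m <= n)%N -> `|t| < m.+1%:R -> P n t = P m t.
  move=> + tm; elim: n => [|n IHn]; first by rewrite leqn0 => /eqP ->.
  rewrite leq_eqVlt => /predU1P[<-//|mn].
  by rewrite PS ?IHn// (lt_le_trans tm)// ler_nat.
exists (fun t => P (Num.truncn `|t|) t) => n t tn.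
have tt : `|t| < (Num.truncn `|t|).+1%:R.
  exact: (real_truncnS_gt (num_real _)).
by have [h|/ltnW h] := leqP n (Num.truncn `|t|); [|symmetry]; exact: Pm.
Qed.

Lemma continuous_primitive g : continuous g ->
  exists2 P : R -> R, P 0 = 0 & forall t, is_derive t 1 P (g t).
Proof.
move=> cg.
(* The integral is a primitive only to the right of its base point, so the base point is sent to
   minus infinity and the primitives are renormalized at 0. *)
pose F (n : nat) (t : R) : R :=
  (\int[lebesgue_measure]_(s in `[(- n.+1%:R)%R, t]) g s)%R.
have FD n t : - n.+1%:R < t -> is_derive t 1 (F n) (g t).
  move=> nt; have [||||dF F'] := @continuous_FTC1_closed R g (- n.+1%:R) t (t + 1).
  - by rewrite ltrDl.
  - apply: continuous_compact_integrable; first exact: segment_compact.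
    exact: continuous_subspaceT.
  - exact: nt.
  - exact: cg.
  apply: DeriveDef => //; first by rewrite -derive1E F'.
pose P n t := F n t - F n 0.
have PD n t : `|t| < n.+1%:R -> is_derive t 1 (P n) (g t).
  rewrite ltr_norml => /andP[nt _]; rewrite -[g t]subr0.
  by apply: is_deriveB; exact: FD.
have P0 n : P n 0 = 0 by rewrite /P subrr.
have [n t tn|Q hQ] := @glue_nat R P.
  (* The difference of two consecutive primitives has zero derivative between 0 and [t] and vanishes
     at 0. *)
  pose d s := P n.+1 s - P n s.
  have dD (s : R) : `|s| < n.+1%:R -> is_derive s 1 d (0 : R).
    move=> sn; rewrite -(subrr (g s)); apply: is_deriveB; apply: PD => //.
    by rewrite (lt_le_trans sn)// ler_nat.
  have tb (s : R) : Num.min 0 t <= s <= Num.max 0 t -> `|s| < n.+1%:R.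
    move: tn; rewrite !ltr_norml ge_min le_max => /andP[h1 h2].
    move=> /andP[/orP[h3|h3] /orP[h4|h4]]; apply/andP; split; lra.
  have [|||c _] := @MVT_segment R d (fun=> 0) (Num.min 0 t) (Num.max 0 t).
  - by rewrite ge_min le_max lexx.
  - move=> x; rewrite in_itv /= => /andP[h1 h2]; apply: dD; apply: tb.
    by rewrite !ltW.
  - apply: derivable_within_continuous => x; rewrite in_itv /= => h.
    by have [] := dD x (tb x h).
  rewrite mul0r => /eqP; rewrite subr_eq0 => /eqP.
  have d0 : d 0 = 0 by rewrite /d !P0 subrr.
  move=> h; have : d t = 0.
    by move: h; rewrite /Num.min /Num.max; case: ifP => _; rewrite d0.
  by move=> /eqP; rewrite subr_eq0 => /eqP.
exists Q => [|t]; first by rewrite (hQ 0%N) ?P0// normr0 ltr0n.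
have tn : `|t| < (Num.truncn `|t|).+1%:R by exact: (real_truncnS_gt (num_real _)).
apply: near_eq_is_derive (PD _ _ tn).
near=> u; symmetry; apply: hQ.
by near: u; exact: near_norm_lt.
Unshelve. all: by end_near. Qed.

End inverse_and_primitive.

(** * Maps of the circle and their lifts *)

Section derive_translation.
Variable R : realType.
Implicit Types (f : R -> R) (x c l : R).

Lemma is_derive1_translate f x c l :
  is_derive (x + c) 1 f l -> is_derive x 1 (fun t => f (t + c)) l.
Proof.
move=> df; rewrite -[l]mulr1.
apply: (@is_derive1_comp R f (fun t => t + c)).
by rewrite -[X in is_derive _ _ _ X]addr0; apply: is_deriveD.
Qed.

Lemma is_derive1_addr f x c l :
  is_derive x 1 f l -> is_derive x 1 (fun t => f t + c) l.
Proof. by move=> df; rewrite -[l]addr0; apply: is_deriveD. Qed.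

End derive_translation.

Section circle_charts.
Variable R : realType.
Local Notation circle := (circle R).
Implicit Types (s t e : R) (x y : circle) (F G : R -> R).

Lemma ang_eqP s t : ang s = ang t <-> exists n : int, t = s + n%:~R.
Proof. by split=> [|[n ->]]; [exact: ang_eq|rewrite angD]. Qed.

Lemma intr_lt1 (n : int) : `|n%:~R : R| < 1 -> n = 0.
Proof.
rewrite -intr_norm -[1]/(1%:~R) ltr_int.
by case: n => [[|n]|n].
Qed.

Lemma circle_ballP s e y :
  circle_ball (ang s) e y <-> exists2 t, ang t = y & `|s - t| < e.
Proof.
split=> [[s' [t [ss ty st]]]|[t ty st]]; last by exists s, t.
have [n sE] : exists n : int, s = s' + n%:~R by exact: ang_eq.
exists (t + n%:~R); first by rewrite angD.
by rewrite sE opprD addrACA subrr addr0.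
Qed.

Lemma circle_ball_ang s t e : `|s - t| < e -> ball (ang s) e (ang t).
Proof. by move=> st; apply/circle_ballP; exists t. Qed.

Lemma continuous_circle (T : topologicalType) (g : circle -> T) :
  continuous (g \o @ang R) -> continuous g.
Proof.
move=> cg x U; have [s <-] := ang_surj x => gU.
have /near_dist [d d0 h] := cg s U gU.
apply/nbhs_ballP; exists d => // y /circle_ballP[t <- st]; exact: h.
Qed.

Lemma circle_ball_sep x y :
  (forall e, 0 < e -> circle_ball x e y) -> x = y.
Proof.
have [s <-] := ang_surj x; have [t <-] := ang_surj y => h.
set r := (t - s) - (Num.floor (t - s))%:~R.
have /andP[r0 r1] : 0 <= r < 1 := frac_bounds (t - s).
have [r00|rn0] := eqVneq r 0.
  apply/ang_eqP; exists (Num.floor (t - s)); move: r00; rewrite /r; lra.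
have {rn0} r0 : 0 < r by rewrite lt_def rn0.
(* Every representative of [ang t] is at distance at least [Num.min r (1 - r)] from [s], so this
   radius is contradictory. *)
have [|t' tt' st'] := (circle_ballP _ _ _).1 (h (Num.min r (1 - r)) _).
  by rewrite lt_min r0 subr_gt0.
have [n tE] := ang_eq tt'.
exfalso; pose k := (n - Num.floor (t - s))%R.
have sE : s - t' = k%:~R - r by rewrite /k /r intrB tE; ring.
move: st'; rewrite sE lt_min !ltr_norml => /andP[/andP[h1 h2] /andP[h3 h4]].
have : (k <= 0)%R || (1 <= k)%R by rewrite -gtz0_ge1; case: leP.
rewrite -!(ler_int R) => /orP[] hk; lra.
Qed.

Lemma circle_hausdorff : hausdorff_space circle.
Proof.
move=> x y h; apply: circle_ball_sep => e e0.
have e2 : 0 < e / 2 by exact: divr_gt0.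
have [z [/= xz yz]] := h _ _ (nbhsx_ballx x _ e2) (nbhsx_ballx y _ e2).
exact: (ball_splitl xz yz).
Qed.

(** The difference of the two functions is an integer that moves by less than 1/2 + 1/2 near [s],
    hence not at all. *)
Lemma near_lift_eq s F G : {for s, continuous F} -> {for s, continuous G} ->
  (\forall t \near s, ang (F t) = ang (G t)) ->
  exists n : int, \forall t \near s, F t = G t + n%:~R.
Proof.
move=> cF cG FG.
have [n Fs] := ang_eq (esym (nbhs_singleton FG)); exists n.
have e0 : 0 < 2^-1 :> R by rewrite invr_gt0.
have [dF dF0 hF] := continuousR_lt cF e0.
have [dG dG0 hG] := continuousR_lt cG e0.
near=> t.
have FGt : ang (F t) = ang (G t) by near: t.
have [m Ft] := ang_eq (esym FGt).
rewrite Ft; congr (_ + _%:~R); apply/eqP; rewrite -subr_eq0; apply/eqP.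
apply: intr_lt1; rewrite intrB.
have -> : m%:~R - n%:~R = (F t - F s) + (G s - G t) by rewrite Ft Fs; ring.
rewrite (le_lt_trans (ler_normD _ _))// [X in _ < X]splitr !mul1r ltrD//.
  by rewrite distrC; apply: hF; near: t; apply/near_dist; exists dF.
by apply: hG; near: t; apply/near_dist; exists dG.
Unshelve. all: by end_near. Qed.

Lemma is_circle_derive_ang (f : circle -> circle) s l :
  is_circle_derive f (ang s) l ->
  exists2 F, is_derive s 1 F l & \forall t \near s, f (ang t) = ang (F t).
Proof.
move=> [s' [F [ss fF dF]]]; have [n sE] := ang_eq (esym ss).
exists (F \o (fun t => t + n%:~R)).
  by apply: is_derive1_translate; rewrite -sE.
move: fF; rewrite sE => /near_dist[d d0 h]; apply/near_dist; exists d => // t st.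
rewrite -(angD t n); apply: h.
by rewrite opprD addrACA subrr addr0.
Qed.

Lemma is_circle_derive_inj (f : circle -> circle) x l l' :
  is_circle_derive f x l -> is_circle_derive f x l' -> l = l'.
Proof.
have [s <-] := ang_surj x.
move=> /is_circle_derive_ang[F dF fF] /is_circle_derive_ang[G dG fG].
have [|n FG] := near_lift_eq (is_derive1_cont dF) (is_derive1_cont dG).
  by near=> t; transitivity (f (ang t)); [symmetry|]; near: t.
have dG' : is_derive s 1 F l'.
  apply: near_eq_is_derive (is_derive1_addr n%:~R dG).
  by near=> t; symmetry; near: t.
by case: dF => _ <-; case: dG'.
Unshelve. all: by end_near. Qed.

Lemma circle_deriveE (f : circle -> circle) x l :
  is_circle_derive f x l -> circle_derive f x = l.
Proof.
move=> h; apply: (is_circle_derive_inj _ h).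
exact: (xgetPex 0 (ex_intro _ l h)).
Qed.

Definition is_lift (f : circle -> circle) F :=
  continuous F /\ forall t, f (ang t) = ang (F t).

(** A continuous lift is automatically differentiable: locally it differs by an integer from the
    differentiable lift in the definition of the derivative. *)
Lemma lift_is_derive (f : C1map R) F : is_lift f F ->
  forall t, is_derive t 1 F (circle_derive f (ang t)).
Proof.
move=> [cF fF] t; have [l hl] := (C1_funP f).1 (ang t).
rewrite (circle_deriveE hl); have [G dG fG] := is_circle_derive_ang hl.
have [|n FG] := near_lift_eq (cF t) (is_derive1_cont dG).
  by near=> u; rewrite -fF; near: u.
apply: near_eq_is_derive (is_derive1_addr n%:~R dG).
by near=> u; symmetry; near: u.
Unshelve. all: by end_near. Qed.

Lemma continuous_derive_ang (f : C1map R) :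
  continuous (fun t => circle_derive f (ang t)).
Proof.
move=> t; apply: (continuous_comp (@ang_continuous R t)).
exact: (C1_funP f).2.
Qed.

Lemma C1map_of_lift F (D : R -> R) (d : int) : continuous D ->
  (forall t, is_derive t 1 F (D t)) -> (forall t, F (t + 1) = F t + d%:~R) ->
  (forall t, D (t + 1) = D t) ->
  exists f : C1map R, is_lift f F /\ forall t, circle_derive f (ang t) = D t.
Proof.
move=> cD FD Fd Dp.
(* The choice of representative is harmless: changing it by an integer changes [F] by an integer. *)
pose f (x : circle) := ang (F (\val (repr x))).
have fF t : f (ang t) = ang (F t).
  have : ang t = ang (\val (repr (ang t))) by rewrite ang_val reprK.
  move=> /ang_eq[n E]; rewrite /f E -[n%:~R]mulr1.
  by rewrite (quasiperiodicz _ Fd) ?oner_neq0// -intrM angD.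
have cF : continuous F by move=> t; exact: is_derive1_cont (FD t).
have fD t : is_circle_derive f (ang t) (D t).
  by exists t, F; split=> //; near=> u.
have f'E t : circle_derive f (ang t) = D t by apply: circle_deriveE.
have fC1 : circle_C1 f.
  split=> [x|]; first by have [t <-] := ang_surj x; exists (D t).
  apply: continuous_circle; rewrite (_ : _ \o _ = D)//.
  by apply/funext => t /=.
by exists (MkC1map fC1).
Unshelve. all: by end_near. Qed.

End circle_charts.

(** * Existence and uniqueness of lifts of continuous maps from the line to the circle *)

Section lifting.
Variable R : realType.
Local Notation circle := (circle R).
Implicit Types (s t c e : R) (x y : circle).

(* The length, taken in [c, c + 1[, of an arc from [x] to [y]. *)
Definition cdiff c x y : R :=
  let r := \val (repr y) - \val (repr x) in r - (Num.floor (r - c))%:~R.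

Lemma cdiffE c s t : c <= t - s < c + 1 -> cdiff c (ang s) (ang t) = t - s.
Proof.
move=> st; rewrite /cdiff.
have /ang_eq[n En] : ang s = ang (\val (repr (ang s))) by rewrite ang_val reprK.
have /ang_eq[m Em] : ang t = ang (\val (repr (ang t))) by rewrite ang_val reprK.
rewrite En Em (_ : Num.floor _ = m - n)%R; first by rewrite intrB; ring.
apply: floor_def; rewrite !intrD mulrNz.
move: st => /andP[h1 h2]; apply/andP; split; lra.
Qed.

Lemma cdiff_bounds c x y : c <= cdiff c x y < c + 1.
Proof.
rewrite /cdiff /=; set r := (X in X - (Num.floor _)%:~R); have /andP[] := frac_bounds (r - c).
by move=> h1 h2; apply/andP; split; lra.
Qed.

Lemma ang_cdiff c s y : ang (s + cdiff c (ang s) y) = y.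
Proof.
rewrite /cdiff.
have /ang_eq[n ->] : ang s = ang (\val (repr (ang s))) by rewrite ang_val reprK.
set m := Num.floor _; rewrite -[RHS]reprK -ang_val.
by apply/ang_eqP; exists (n + m)%R; rewrite intrD; ring.
Qed.

(** [cdiff c] jumps only where its value is [c]. Elsewhere the length lies strictly between [c] and
    [c + 1] and stays there under small moves of both ends. *)
Lemma cdiff_near c s y : cdiff c (ang s) y != c ->
  exists2 d : R, 0 < d & forall s' t', `|s - s'| < d ->
    `|s + cdiff c (ang s) y - t'| < d -> cdiff c (ang s') (ang t') = t' - s'.
Proof.
move=> yc; have /andP[h1 h2] := cdiff_bounds c (ang s) y.
set r := cdiff c (ang s) y in h1 h2 yc *.
have {}h1 : c < r by rewrite lt_def yc.
(* Half the distance to the ends of the interval, since [t' - s'] can move by twice the radius. *)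
exists (Num.min (r - c) (c + 1 - r) / 2).
  by apply: divr_gt0 => //; rewrite lt_min !subr_gt0 h1 h2.
move=> s' t'; rewrite !ltr_pdivlMr// !lt_min => /andP[a1 a2] /andP[b1 b2].
apply: cdiffE.
have n1 := ler_norm (s - s'); have n2 := ler_norm (- (s - s')).
have n3 := ler_norm (s + r - t'); have n4 := ler_norm (- (s + r - t')).
rewrite normrN in n2; rewrite normrN in n4.
by apply/andP; split; lra.
Qed.

Lemma cdiff_continuous c x y : cdiff c x y != c ->
  {for (x, y), continuous (fun z : circle * circle => cdiff c z.1 z.2)}.
Proof.
have [s <-] := ang_surj x => yc; have [d d0 hd] := cdiff_near yc.
apply/cvgrPdist_lt => e e0 /=.
pose d' := Num.min d (e / 2).
have d'0 : 0 < d' by rewrite lt_min d0 divr_gt0.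
exists (ball (ang s) d', ball y d'); first by split; exact: nbhsx_ballx.
move=> [x' y'] /= [] /circle_ballP[s' <- ss'].
rewrite -{1}(ang_cdiff c s y) => /circle_ballP[t' <- tt'].
rewrite hd.
- move: ss' tt'; rewrite !lt_min => /andP[_ h1] /andP[_ h2].
  have -> : cdiff c (ang s) y - (t' - s') =
    (s + cdiff c (ang s) y - t') - (s - s') by ring.
  by rewrite (le_lt_trans (ler_normB _ _))// [e]splitr ltrD.
- by move: ss'; rewrite lt_min => /andP[].
- by move: tt'; rewrite lt_min => /andP[].
Qed.

Let clampB (B t : R) : R := Num.max (- B) (Num.min B t).

Let clampB_id (B t : R) : `|t| <= B -> clampB B t = t.
Proof.
rewrite ler_norml => /andP[h1 h2].
by rewrite /clampB min_r// max_r.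
Qed.

Let clampB_le (B t : R) : 0 <= B -> `|clampB B t| <= B.
Proof.
move=> B0; rewrite ler_norml /clampB le_max lexx /= ge_max ge_min lexx.
by rewrite andbT (le_trans _ B0)// oppr_le0.
Qed.

Let clampB_cont B : continuous (clampB B).
Proof.
move=> t; apply: (@continuous_max R R (cst (- B)) (cst B \min id) t).
  exact: cst_continuous.
by apply: (@continuous_min R R (cst B) id t) => //; exact: cst_continuous.
Qed.

(* On a bounded interval, [g] is lifted by adding up the short arcs joining the
   images of the points [k t / N], [k <= N]. *)
Lemma segment_lift (g : R -> circle) s (B : R) : 0 <= B ->
  continuous g -> g 0 = ang s ->
  exists L : R -> R, [/\ continuous L, L 0 = s &
    forall t, `|t| <= B -> ang (L t) = g t].
Proof.
move=> B0 cg g0.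
have h0 : 0 < 2^-1 :> R by rewrite invr_gt0.
have [d d0 hd] := segment_unif_cont (- B) B cg h0.
(* With this [N], consecutive subdivision points are less than [d] apart, so their images are less
   than 1/2 apart and [cdiff (- 2^-1)] avoids its jump. *)
pose N := (Num.truncn (B / d)).+1.
have N0 : 0 < N%:R :> R by rewrite ltr0n.
have BN : B / N%:R < d.
  rewrite ltr_pdivrMr// mulrC -ltr_pdivrMr// /N; exact: (real_truncnS_gt (num_real _)).
(* Clamping freezes the time outside the interval, so that the lift is continuous on the whole
   line. *)
pose tau k t := clampB B t * (k%:R / N%:R).
have ctau k : continuous (g \o tau k).
  apply: (@continuous_compf R R circle (tau k) g) => //.
  exact: (continuous_compf (@clampB_cont B) (@mulrr_continuous R (k%:R / N%:R))).
pose c k t := cdiff (- 2^-1) (g (tau k t)) (g (tau k.+1 t)).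
have cne k t : (k < N)%N -> c k t != - 2^-1.
  move=> kN; have Bt := clampB_le t B0.
  have : ball (g (tau k t)) 2^-1 (g (tau k.+1 t)).
    apply: hd.
      rewrite -ler_norml /tau normrM -[B in _ <= B]mulr1.
      rewrite ler_pM// ger0_norm ?divr_ge0// ler_pdivrMr// mul1r ler_nat.
      exact: ltnW.
    rewrite /tau -natr1 -mulrBr.
    have -> : k%:R / N%:R - (k%:R + 1) / N%:R = - N%:R^-1 :> R by ring.
    have N'0 : 0 < N%:R^-1 :> R by rewrite invr_gt0.
    rewrite normrM normrN (gtr0_norm N'0).
    by rewrite (le_lt_trans _ BN)// ler_pM2r.
  rewrite /c; have [a <-] := ang_surj (g (tau k t)).
  move=> /circle_ballP[b <-]; rewrite ltr_norml => /andP[h1 h2].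
  rewrite cdiffE; last by apply/andP; split; lra.
  by apply/eqP; lra.
pose L j t := s + \sum_(k < j) c k t.
have LP j : (j <= N)%N -> continuous (L j) /\ forall t, ang (L j t) = g (tau j t).
  elim: j => [_|j IHj jN].
    split=> [|t]; last by rewrite /L /tau big_ord0 addr0 !mul0r mulr0 g0.
    rewrite (_ : L 0%N = cst s); first exact: cst_continuous.
    by apply/funext => t; rewrite /L big_ord0 addr0.
  have [cL aL] := IHj (ltnW jN).
  have LS t : L j.+1 t = L j t + c j t by rewrite /L big_ord_recr addrA.
  split=> [t|t].
    rewrite (_ : L j.+1 = L j \+ c j); last exact/funext.
    apply: (@continuousD R R R (L j) (c j)); first exact: cL.
    apply: (@continuous_comp _ _ _ (fun t => (g (tau j t), g (tau j.+1 t)))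
      (fun z => cdiff (- 2^-1) z.1 z.2)).
      exact: (continuous_pairf (ctau j) (ctau j.+1)).
    by apply: cdiff_continuous; exact: cne.
  by rewrite LS /c -aL ang_cdiff.
have [cL aL] := LP N (leqnn N).
exists (L N); split=> // [|t tB].
  rewrite /L big1 ?addr0// => k _; rewrite /c /tau clampB_id ?normr0//.
  by rewrite !mul0r g0 -[s in cdiff _ _ (ang s)]addr0 cdiffE; lra.
by rewrite aL /tau divff ?gt_eqF// mulr1 clampB_id.
Qed.

Lemma lift_uniq (L M : R -> R) : continuous L -> continuous M ->
  (forall t, ang (L t) = ang (M t)) ->
  exists n : int, forall t, L t = M t + n%:~R.
Proof.
move=> cL cM LM; have hd t : exists n : int, L t - M t = n%:~R.
  by have [n ->] := ang_eq (esym (LM t)); exists n; ring.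
have cD : continuous (fun t => L t - M t).
  by move=> t; apply: (@continuousB R R^o R); [exact: cL|exact: cM].
have [n hn] := hd 0; exists n => t.
by rewrite -hn (integer_valued_const cD hd 0 t); ring.
Qed.

Lemma lift_exists (g : R -> circle) s : continuous g -> g 0 = ang s ->
  exists L : R -> R, [/\ continuous L, L 0 = s & forall t, ang (L t) = g t].
Proof.
move=> cg g0.
have /choice[P HP] (n : nat) := @segment_lift g s n.+1%:R (ler0n _ _) cg g0.
have [n t tn|L hL] := @glue_nat R R P.
  have [c1 s1 a1] := HP n.+1; have [c2 s2 a2] := HP n.
  (* The two lifts need only agree up to an integer on the smaller interval; composing with the
     clamp makes [lift_uniq] applicable, and the value at 0 shows that the integer is 0. *)
  pose k u := clampB n.+1%:R u.
  have kn u : `|k u| <= n.+1%:R by exact: clampB_le.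
  have [||u|m hm] := @lift_uniq (P n.+1 \o k) (P n \o k).
  - by move=> u; apply: continuous_comp; [exact: clampB_cont|exact: c1].
  - by move=> u; apply: continuous_comp; [exact: clampB_cont|exact: c2].
  - by rewrite /= a1 ?a2// (le_trans (kn u))// ler_nat.
  have k0 : k 0 = 0 by rewrite /k clampB_id// normr0.
  have := hm 0; rewrite /= k0 s1 s2 => /eqP; rewrite -subr_eq0 opprD addrA subrr.
  rewrite sub0r oppr_eq0 => /eqP m0.
  by have := hm t; rewrite m0 addr0 /= /k clampB_id// ltW.
have tt (t : R) : `|t| < (Num.truncn `|t|).+1%:R by exact: (real_truncnS_gt (num_real _)).
exists L; split=> [t|//|t].
- have [c1 _ _] := HP (Num.truncn `|t|).
  apply: near_eq_continuous (c1 t).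
  near=> u; symmetry; apply: hL.
  by near: u; exact: near_norm_lt.
- by rewrite (hL 0%N) ?normr0//; have [] := HP 0%N.
- rewrite (hL _ _ (tt t)); have [_ _ ->//] := HP (Num.truncn `|t|).
  exact: ltW.
Unshelve. all: by end_near. Qed.

End lifting.

(** * The topologies *)

Lemma nbhs_initialP (S : choiceType) (T : topologicalType) (f : S -> T)
    (x : initial_topology f) (P : set (initial_topology f)) :
  nbhs x P <-> exists2 Q, nbhs (f x) Q & forall y, Q (f y) -> P y.
Proof.
split=> [[A [[B oB <-] Bx] BP]|[Q fQ QP]].
  by exists B; [exact: open_nbhs_nbhs|exact: BP].
have h : nbhs x (f @^-1` Q) by exact: (@initial_continuous S T f x Q fQ).
by apply: filterS h => y; exact: QP.
Qed.

Lemma nbhs_set_typeP (X : topologicalType) (A : set X) (x : A) (P : set A) :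
  nbhs x P <-> exists2 Q, nbhs (\val x) Q & forall y : A, Q (\val y) -> P y.
Proof. exact: (@nbhs_initialP A X \val x P). Qed.

Lemma nbhs_uniformP (R : realType) (U : choiceType) (V : pseudoMetricType R)
    (f : {uniform U -> V}) (P : set {uniform U -> V}) :
  nbhs f P <-> exists2 e : R, 0 < e &
    forall g : {uniform U -> V}, (forall x, ball (f x) e (g x)) -> P g.
Proof.
split=> [/uniform_nbhs[E [/= ]]|[e e0 eP]].
  rewrite -entourage_ballE => -[e /= e0 eE] EP; exists e => // g fg.
  by apply: EP => y _; apply: eE; exact: fg.
apply/uniform_nbhs; exists [set xy | ball xy.1 e xy.2]; split.
  by rewrite -entourage_ballE; exists e.
by move=> g h; apply: eP => x; exact: h.
Qed.

Section C1_topology.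
Variable R : realType.
Local Notation circle := (circle R).

Definition C1_close (e : R) (f g : C1map R) : Prop :=
  (forall x, ball (f x) e (g x)) /\
  forall x, `|circle_derive f x - circle_derive g x| < e.

Lemma nbhs_C1P (f : C1map R) (P : set (C1map R)) :
  nbhs f P <-> exists2 e : R, 0 < e & forall g, C1_close e f g -> P g.
Proof.
split=> [/(@nbhs_initialP _ _ (@C1_jet R))[Q [[A B] /= [fA fB] ABQ] QP]|].
  have [a a0 ha] := (nbhs_uniformP _ _).1 fA.
  have [b b0 hb] := (nbhs_uniformP _ _).1 fB.
  exists (Num.min a b); first by rewrite lt_min a0.
  move=> g [h1 h2]; apply: QP; apply: ABQ; split.
    by apply: ha => x; apply: le_ball (h1 x); rewrite ge_min lexx.
  apply: hb => x; apply: (lt_le_trans (h2 x)).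
  by rewrite ge_min lexx orbT.
move=> [e e0 eP]; apply/(@nbhs_initialP _ _ (@C1_jet R)).
exists [set g | (forall x, ball (f x) e (g.1 x)) /\
    (forall x, `|circle_derive f x - g.2 x| < e)]; last first.
  by move=> g; exact: eP.
exists ([set g | forall x, ball (f x) e (g x)],
  [set g | forall x, `|circle_derive f x - g x| < e]); last by [].
by split; apply/nbhs_uniformP; exists e.
Qed.

Lemma C1map_eq (f g : C1map R) : (f : circle -> circle) = g -> f = g.
Proof.
by case: f g => [f fP] [g gP] /= fg; subst g; congr MkC1map; exact: Prop_irrelevance.
Qed.

Lemma C1_close_sep (f g : C1map R) :
  (forall e, 0 < e -> C1_close e f g) -> f = g.
Proof.
move=> h; apply: C1map_eq; apply/funext => x; apply: circle_ball_sep => e e0.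
exact: (h e e0).1.
Qed.

Lemma nbhs_C1_subP (S : set (C1map R)) (f : S) (P : set S) :
  nbhs f P <-> exists2 e : R, 0 < e &
    forall g : S, C1_close e (\val f) (\val g) -> P g.
Proof.
split=> [/nbhs_set_typeP[Q /nbhs_C1P[e e0 eQ] QP]|[e e0 eP]].
  by exists e => // g /eQ; exact: QP.
apply/nbhs_set_typeP; exists (C1_close e (\val f)) => //.
by apply/nbhs_C1P; exists e.
Qed.

End C1_topology.

Section antiperiodic.
Variable R : realType.

Definition antiperiodic : set {uniform R -> R} :=
  [set u | continuous (u : R -> R) /\ forall t, u (t + 1) = - u t].

Definition apfun (u : antiperiodic) : R -> R := \val u.

Implicit Types (u w : antiperiodic) (t : R).

Lemma apfun_inj u w : apfun u =1 apfun w -> u = w.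
Proof. by move=> uw; apply: val_inj; apply/funext. Qed.

Lemma apfun_cont u : continuous (apfun u).
Proof. by have [] := set_valP u. Qed.

Lemma apfunD1 u t : apfun u (t + 1) = - apfun u t.
Proof. by have [_ h] := set_valP u; exact: h. Qed.

Lemma apfunD2 u t : apfun u (t + 2) = apfun u t.
Proof. by rewrite (_ : t + 2 = t + 1 + 1) ?apfunD1 ?opprK//; ring. Qed.

Lemma apfun_ex (f : R -> R) : continuous f -> (forall t, f (t + 1) = - f t) ->
  exists u, apfun u = f.
Proof.
move=> cf fp; have fE : f \in (antiperiodic : set (R -> R)) by rewrite inE.
by exists (SigSub fE).
Qed.

Lemma apfun_bounded u : exists2 B : R, 0 < B & forall t, `|apfun u t| <= B.
Proof.
exact: periodic_bounded (ltr0Sn R 1) (apfunD2 u) (@apfun_cont u).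
Qed.

Lemma nbhs_apP u (P : set antiperiodic) :
  nbhs u P <-> exists2 e : R, 0 < e & forall w,
    (forall t, `|apfun u t - apfun w t| < e) -> P w.
Proof.
split=> [/nbhs_set_typeP[Q /nbhs_uniformP[e e0 eQ] QP]|[e e0 eP]].
  by exists e => // w uw; apply: QP; apply: eQ.
apply/nbhs_set_typeP; exists [set w | forall t, ball (apfun u t) e (w t)] => //.
by apply/nbhs_uniformP; exists e.
Qed.

End antiperiodic.

Arguments antiperiodic R : clear implicits.

(** * Winding numbers *)

Local Open Scope quotient_scope.

Section path_of_fun.
Variables (R : realType) (X : topologicalType) (x y : X) (f : I01 R -> X).
Hypotheses (cf : continuous f) (f0 : f zero = x) (f1 : f one = y).

(* The proofs are arguments so that the path structure can be inferred. *)
Definition path_fun (_ : continuous f) (_ : f zero = x) (_ : f one = y) := f.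

HB.instance Definition _ :=
  isContinuous.Build (I01 R) X (path_fun cf f0 f1) cf.
HB.instance Definition _ :=
  isPath.Build (I01 R) X x y (path_fun cf f0 f1) f0 f1.

Lemma path_of_fun : exists p : {path (I01 R) from x to y in X}, p =1 f.
Proof. by exists (path_fun cf f0 f1). Qed.

End path_of_fun.

Section degree.
Variable R : realType.
Local Notation circle := (circle R).
Local Notation I := (I01 R).

Definition has_winding (g : I -> circle) (n : int) : Prop :=
  exists L : R -> R, [/\ continuous L, forall t, ang (L t) = g (clampI t)
    & L 1 - L 0 = n%:~R].

Lemma winding_exists (g : I -> circle) : continuous g -> g zero = g one ->
  exists n, has_winding g n.
Proof.
move=> cg g01; have cgc := continuous_compf (@continuous_clampI R) cg.
have [s gs] := ang_surj (g (clampI 0)).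
have [L [cL _ LE]] := lift_exists cgc (esym gs).
have /ang_eq[n Ln] : ang (L 0) = ang (L 1) by rewrite !LE.
by exists n, L; split=> //; rewrite Ln; ring.
Qed.

(** The difference of the two lifts stays within 1/4 of one fixed integer, so [n - m], its variation
    from 0 to 1, is smaller than 1/2 in absolute value. *)
Lemma winding_close (g g' : I -> circle) (n m : int) :
  (forall s, ball (g s) 4^-1 (g' s)) -> has_winding g n -> has_winding g' m ->
  n = m.
Proof.
move=> gg' [L [cL LE Ln]] [M [cM ME Mm]].
have cD : continuous (fun t => L t - M t).
  by move=> t; apply: (@continuousB R R^o R); [exact: cL|exact: cM].
have [||k hk] := @near_integer_const R _ 4^-1 cD.
- lra.
- move=> t; have := gg' (clampI t); rewrite -LE -ME => /circle_ballP[u uM Lu].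
  by have [k uE] := ang_eq (esym uM); exists k; move: Lu; rewrite uE opprD addrA.
apply/eqP; rewrite -subr_eq0; apply/eqP; apply: (@intr_lt1 R).
have := hk 0; have := hk 1; rewrite intrB -Ln -Mm !ltr_norml.
by move=> /andP[h1 h2] /andP[h3 h4]; apply/andP; split; lra.
Qed.

Lemma winding_uniq (g g' : I -> circle) (n m : int) : g =1 g' ->
  has_winding g n -> has_winding g' m -> n = m.
Proof.
by move=> gg'; apply: winding_close => s; rewrite gg'; exact: ballxx.
Qed.

(** By compactness of the loop parameter, nearby times give uniformly close loops. The winding
    number is thus a locally constant function of time. *)
Lemma winding_homotopy (H : I * I -> circle) (n m : int) : continuous H ->
  (forall t, H (zero, t) = H (one, t)) ->
  has_winding (fun s => H (s, zero)) n -> has_winding (fun s => H (s, one)) m ->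
  n = m.
Proof.
move=> cH H01 Hn Hm.
have wE (tau : R) : exists k, has_winding (fun s => H (s, clampI tau)) k.
  apply: winding_exists; last exact: H01.
  apply: continuous_compf cH; apply: continuous_pairf => s.
    exact: cvg_id.
  exact: cst_continuous.
have /choice[w hw] := wE.
have cw : continuous (fun tau => (w tau)%:~R : R).
  move=> tau; apply: (@near_eq_continuous R R (cst (w tau)%:~R)); last first.
    exact: cst_continuous.
  have /compact_near_coveringP cab := @segment_compact R 0 1.
  have cK : continuous (fun z : R * R => H (clampI z.1, clampI z.2)).
    apply: continuous_compf cH; apply: continuous_pairf.
      exact: continuous_compf (@continuous_fst _ _) (@continuous_clampI R).
    exact: continuous_compf (@continuous_snd _ _) (@continuous_clampI R).
  have := cab R (nbhs tau) (fun tau' s =>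
    ball (H (clampI s, clampI tau)) 4^-1 (H (clampI s, clampI tau'))) _.
  case.
    move=> s _.
    have h0 : 0 < 4^-1 / 2 :> R by rewrite divr_gt0.
    have [[A B] /= [sA tB] AB] := cK (s, tau) _ (nbhsx_ballx _ _ h0).
    exists (A, B) => // -[s' tau'] /= [As' Bt'].
    apply: (@ball_splitr _ _ (H (clampI s, clampI tau))).
      by apply: (AB (s', tau)); split=> //=; exact: nbhs_singleton.
    exact: (AB (s', tau')).
  move=> r r0 hr; apply/near_dist; exists r => // tau' tt'; congr _%:~R.
  apply: winding_close (hw tau) (hw tau') => s.
  rewrite -(clampIK s); apply: (hr tau') => //=.
  by rewrite in_itv /= I01_bounds.
have w01 : w 0 = w 1.
  apply/eqP; rewrite -(eqr_int R); apply/eqP.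
  by apply: integer_valued_const cw _ 0 1 => t; exists (w t).
rewrite (winding_uniq (fun=> erefl) Hn (hw 0)) w01.
exact: (winding_uniq (fun=> erefl) (hw 1) Hm).
Qed.

End degree.

(** * Arcs and loops in the product of the circle with a convex space *)

Section winding_of_loops.
Variables (R : realType) (X : topologicalType) (theta : X -> circle R) (x0 : X).
Hypothesis ctheta : continuous theta.
Local Notation I := (I01 R).
Local Notation loop := {path I from x0 to x0 in X}.

Lemma loop_continuous (p : loop) : continuous (theta \o p).
Proof. exact: continuous_compf cts_fun ctheta. Qed.

Lemma loop_winding_exists (p : loop) : exists n, has_winding (theta \o p) n.
Proof.
apply: winding_exists; first exact: loop_continuous.
by rewrite /= path_zero path_one.
Qed.

Lemma loop_winding_homotopic (p q : loop) n m : path_homotopic p q ->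
  has_winding (theta \o p) n -> has_winding (theta \o q) m -> n = m.
Proof.
case=> H [cH H0 H1 Hx Hy] pn qm.
apply: (@winding_homotopy R (theta \o H)).
- exact: continuous_compf cH ctheta.
- by move=> t /=; rewrite Hx Hy.
- by rewrite (_ : (fun s => _) = theta \o p)//; apply/funext => s /=; rewrite H0.
- by rewrite (_ : (fun s => _) = theta \o q)//; apply/funext => s /=; rewrite H1.
Qed.

Lemma loop_winding_mul (p q : loop) n m :
  has_winding (theta \o p) n -> has_winding (theta \o q) m ->
  has_winding (theta \o (path_mul p q : loop)) (n + m).
Proof.
move=> pn qm; have [w [L [cL LE Lw]]] := loop_winding_exists (path_mul p q : loop).
have cc := @continuous_clamp R.
(* One lift [L] of the concatenation yields lifts of both factors: [a = 0] reads its first half and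
   [a = 1] its second half. *)
have cM (a : R) : continuous (fun t => L ((clamp t + a) / 2)).
  suff cs : continuous (fun t => (clamp t + a) / 2) by exact: continuous_compf cs cL.
  move=> t; apply: (@continuousM R R (fun t => clamp t + a) (cst 2^-1)).
    by apply: (@continuousD R R R _ (cst a)); [exact: cc|exact: cst_continuous].
  exact: cst_continuous.
have c01 (t : R) : 0 <= clamp t <= 1 by rewrite -[clamp t]/(\val (clampI t)) I01_bounds.
have pE t : ang (L ((clamp t + 0) / 2)) = theta (p (clampI t)).
  have /andP[t0 t1] := c01 t; rewrite LE /= /path_mul /= addr0.
  rewrite clamp_id; last by apply/andP; split; lra.
  rewrite ifT; last by lra.
  by rewrite mulrC divfK ?pnatr_eq0// -[clamp t]/(\val (clampI t)) clampIK.
have qE t : ang (L ((clamp t + 1) / 2)) = theta (q (clampI t)).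
  have /andP[t0 t1] := c01 t; rewrite LE /= /path_mul /=.
  rewrite clamp_id; last by apply/andP; split; lra.
  have -> : 2 * ((clamp t + 1) / 2) = clamp t + 1 by field.
  (* At the midpoint [path_mul] uses its first branch, so the value is the end of [p], which is also
     the start of [q]. *)
  case: ifPn => [h|_].
    have ct0 : clamp t = 0 by lra.
    have -> : clampI t = zero by apply: val_inj; rewrite val_zeroI /= ct0.
    by rewrite ct0 add0r path_one path_zero.
  by rewrite addrK -[clamp t]/(\val (clampI t)) clampIK.
have clamp0 : clamp 0 = 0 :> R by rewrite clamp_id// lexx ler01.
have clamp1 : clamp 1 = 1 :> R by rewrite clamp_id// lexx ler01.
have e0 : (clamp 0 + 0) / 2 = 0 :> R by rewrite clamp0 addr0 mul0r.
have e1 : (clamp 1 + 0) / 2 = (clamp 0 + 1) / 2 :> R by rewrite clamp0 clamp1 addrC.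
have e2 : (clamp 1 + 1) / 2 = 1 :> R by rewrite clamp1; field.
have [n' Ln'] : exists n' : int, L ((clamp 1 + 0) / 2) = L ((clamp 0 + 0) / 2) + n'%:~R.
  by apply: ang_eq; rewrite !pE -[clampI 0]/zero -[clampI 1]/one path_zero path_one.
have [m' Lm'] : exists m' : int, L ((clamp 1 + 1) / 2) = L ((clamp 0 + 1) / 2) + m'%:~R.
  by apply: ang_eq; rewrite !qE -[clampI 0]/zero -[clampI 1]/one path_zero path_one.
have -> : n = n'.
  apply: (winding_uniq (fun=> erefl) pn).
  exists (fun t => L ((clamp t + 0) / 2)); split=> //.
  by rewrite Ln' [LHS]addrAC subrr add0r.
have -> : m = m'.
  apply: (winding_uniq (fun=> erefl) qm).
  exists (fun t => L ((clamp t + 1) / 2)); split=> //.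
  by rewrite Lm' [LHS]addrAC subrr add0r.
have L1 : L 1 = L 0 + n'%:~R + m'%:~R by rewrite -[in LHS]e2 Lm' -e1 Ln' e0.
by exists L; split=> //; rewrite intrD L1; ring.
Qed.

End winding_of_loops.

Section compact_embedding.

Lemma compact_injective_embedding (K X : topologicalType) (f : K -> X) :
  compact [set: K] -> hausdorff_space X -> continuous f -> injective f ->
  topological_embedding f.
Proof.
move=> cK hX cf finj; split=> // U; split=> [oU|[V oV ->]]; last first.
  by move/continuousP : cf; exact.
(* The complement of [U] is compact, hence so is its image, which is closed since [X] is
   Hausdorff. *)
exists (~` (f @` ~` U)).
  apply: closed_openC; apply: compact_closed => //.
  apply: continuous_compact; first exact: continuous_subspaceT.
  by apply: subclosed_compact cK _ => //; exact: open_closedC.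
apply/seteqP; split=> z /=; first by move=> Uz [w Uw /finj wz]; apply: Uw; rewrite wz.
by move=> h; apply: contrapT => Uz; apply: h; exists z.
Qed.

Lemma compact_I01 (R : realType) : compact [set: I01 R].
Proof.
rewrite (_ : setT = @clampI R @` `[0, 1]%classic).
  apply: continuous_compact; last exact: segment_compact.
  by apply: continuous_subspaceT; exact: continuous_clampI.
apply/seteqP; split=> // x _; exists (\val x); last exact: clampIK.
by rewrite /= in_itv /= I01_bounds.
Qed.

Lemma injective_hausdorff (X Y : topologicalType) (f : X -> Y) :
  continuous f -> injective f -> hausdorff_space Y -> hausdorff_space X.
Proof.
move=> cf finj hY x y xy; apply: finj; apply: hY => A B fA fB.
have [z [Az Bz]] := xy _ _ (cf x A fA) (cf y B fB).
by exists (f z).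
Qed.

Lemma prod_hausdorff (X Y : topologicalType) :
  hausdorff_space X -> hausdorff_space Y -> hausdorff_space (X * Y)%type.
Proof.
move=> hX hY [x y] [x' y'] xy; congr pair.
  apply: hX => A B xA xB.
  have [[z w] [/= zA zB]] := xy _ _ (@cvg_fst _ _ (nbhs x) (nbhs y) _ A xA)
    (@cvg_fst _ _ (nbhs x') (nbhs y') _ B xB).
  by exists z.
apply: hY => A B yA yB.
have [[z w] [/= zA zB]] := xy _ _ (@cvg_snd _ _ (nbhs x) (nbhs y) _ A yA)
  (@cvg_snd _ _ (nbhs x') (nbhs y') _ B yB).
by exists w.
Qed.

End compact_embedding.

Lemma line_continuous (R : realType) (Z : topologicalType) (a b t : Z -> R) :
  continuous a -> continuous b -> continuous t ->
  continuous (fun z => (1 - t z) * a z + t z * b z).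
Proof.
move=> ca cb ct z; apply: (@continuousD R R Z); last first.
  by apply: (@continuousM R Z); [exact: ct|exact: cb].
apply: (@continuousM R Z); last exact: ca.
by apply: (@continuousB R R Z); [exact: cst_continuous|exact: ct].
Qed.

Section circle_times_convex.
Variables (R : realType) (X E : topologicalType).
Variables (h : X -> circle R * E) (k : circle R * E -> X).
Hypotheses (hK : cancel h k) (kK : cancel k h).
Hypotheses (ch : continuous h) (ck : continuous k).
(** [conv a b] stands for the segment from [a] to [b]. Its constancy when [a = b] keeps homotopies
    fixed at the base point; its injectivity when [a] and [b] differ makes segments arcs. *)
Variable conv : E -> E -> R -> E.
Hypothesis conv_cont : continuous (fun z : (E * E) * R => conv z.1.1 z.1.2 z.2).
Hypotheses (conv0 : forall a b, conv a b 0 = a) (conv1 : forall a b, conv a b 1 = b).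
Hypothesis convxx : forall a t, conv a a t = a.
Hypothesis conv_inj : forall a b s t, a <> b -> conv a b s = conv a b t -> s = t.
Local Notation I := (I01 R).

Let theta x := (h x).1.
Let eta x := (h x).2.

Let ctheta : continuous theta.
Proof. exact: continuous_compf ch (@continuous_fst _ _). Qed.

Let ceta : continuous eta.
Proof. exact: continuous_compf ch (@continuous_snd _ _). Qed.

Let kE x : k (theta x, eta x) = x.
Proof. by rewrite -[RHS]hK /theta /eta; case: (h x). Qed.

(** Shifted to start at the same real number, the two lifts also end at the same one because the
    winding numbers agree. The straight-line homotopy between them hence fixes the endpoints. *)
Lemma winding_homotopic x0 (p q : {path I from x0 to x0 in X}) n :
  has_winding (theta \o p) n -> has_winding (theta \o q) n -> path_homotopic p q.
Proof.
move=> [L [cL LE Ln]] [M [cM ME Mn]].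
have [j Lj] : exists j : int, L 0 = M 0 + j%:~R.
  by apply: ang_eq; rewrite LE ME /= -[clampI 0]/zero !path_zero.
pose H (z : I * I) : X := k (ang ((1 - \val z.2) * L (\val z.1) +
  \val z.2 * (M (\val z.1) + j%:~R)),
  conv (eta (p z.1)) (eta (q z.1)) (\val z.2)).
have cv := @continuous_valI R.
have cp := continuous_compf (@cts_fun _ _ p) ceta.
have cq := continuous_compf (@cts_fun _ _ q) ceta.
have cM' : continuous (fun t => M t + j%:~R).
  by move=> t; apply: (@continuousD R R R); [exact: cM|exact: cst_continuous].
have c1 := @continuous_fst I I; have c2 := @continuous_snd I I.
exists H; split=> [|s|s|t|t].
- apply: continuous_compf ck; apply: continuous_pairf.
    apply: continuous_compf (@ang_continuous R); apply: line_continuous.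
    + exact: continuous_compf (continuous_compf c1 cv) cL.
    + exact: continuous_compf (continuous_compf c1 cv) cM'.
    + exact: continuous_compf c2 cv.
  exact: continuous_compf (continuous_pairf (continuous_pairf
    (continuous_compf c1 cp) (continuous_compf c1 cq))
    (continuous_compf c2 cv)) conv_cont.
- rewrite /H val_zeroI subr0 mul1r mul0r addr0 conv0 LE clampIK.
  exact: kE.
- rewrite /H val_oneI subrr mul1r mul0r add0r conv1 angD ME clampIK.
  exact: kE.
- rewrite /H val_zeroI /= -Lj !path_zero convxx -mulrDl subrK mul1r LE.
  by rewrite -[clampI 0]/zero /= path_zero kE.
- have L1 : L 1 = M 1 + j%:~R.
    by apply/eqP; rewrite -subr_eq0; apply/eqP; move: Ln Mn Lj; lra.
  rewrite /H val_oneI /= -L1 !path_one convxx -mulrDl subrK mul1r LE.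
  by rewrite -[clampI 1]/one /= path_one kE.
Qed.

Lemma winding_surj x0 (n : int) :
  exists p : {path I from x0 to x0 in X}, has_winding (theta \o p) n.
Proof.
have [s hs] := ang_surj (theta x0).
pose L (t : R) := s + n%:~R * t.
have cL : continuous L.
  move=> t; apply: (@continuousD R R R); first exact: cst_continuous.
  exact: mulrl_continuous.
pose f (t : I) := k (ang (L (\val t)), eta x0).
have kx : k (ang s, eta x0) = x0 by rewrite hs kE.
have [|||p pE] := @path_of_fun R X x0 x0 f.
- apply: continuous_compf ck; apply: continuous_pairf.
    exact: continuous_compf (continuous_compf (@continuous_valI R) cL)
      (@ang_continuous R).
  by move=> t; exact: cst_continuous.
- by rewrite /f val_zeroI /L mulr0 addr0.
- by rewrite /f val_oneI /L mulr1 angD.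
(* [has_winding] asks for a lift of the loop extended by constants outside the unit interval, hence
   the clamp. *)
exists p; exists (L \o @clamp R); split.
- exact: continuous_compf (@continuous_clamp R) cL.
- by move=> t /=; rewrite pE /f /theta kK.
- by rewrite /L /= !clamp_id ?lexx ?ler01//; ring.
Qed.

Lemma pi1_circle_times_convex (x0 : X) : pi1_iso_int R x0.
Proof.
have /choice[w hw] := @loop_winding_exists R X theta x0 ctheta.
pose phi (a : pi1 R x0) : int := w (repr a).
have repr_pi (p : {path I from x0 to x0 in X}) :
    path_homotopic (repr (\pi_(pi1 R x0) p)) p.
  by apply/asboolP; apply/(@eqmodP _ (loop_equiv R x0)); rewrite reprK.
have phi_pi (p : {path I from x0 to x0 in X}) n :
    has_winding (theta \o p) n -> phi (\pi_(pi1 R x0) p) = n.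
  by move=> pn; exact: (loop_winding_homotopic ctheta (repr_pi p) (hw _) pn).
have /choice[psi hpsi] n : exists a, phi a = n.
  have [p pn] := winding_surj x0 n; exists (\pi_(pi1 R x0) p); exact: phi_pi.
have phi_inj : injective phi.
  move=> a b ab; rewrite -[a]reprK -[b]reprK; apply/eqmodP/asboolP.
  by apply: (@winding_homotopic _ _ _ (phi a)); [|rewrite ab]; exact: hw.
exists phi; split.
  by exists psi => // a; apply: phi_inj; rewrite hpsi.
by move=> a b; apply: phi_pi; apply: loop_winding_mul => //; exact: hw.
Qed.

(** The path turns in the positive direction by [r < 1] while its [E] coordinate follows a segment.
    If the ends differ in [E], the segment already separates the times; otherwise [r] is positive
    and the circular arc does not close up. *)
Lemma arc_connected_circle_times_convex : hausdorff_space E -> arc_connected R X.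
Proof.
move=> hE x y xy.
have hX : hausdorff_space X.
  apply: injective_hausdorff ch (can_inj hK) _.
  by apply: prod_hausdorff hE; exact: circle_hausdorff.
have [s hs] := ang_surj (theta x).
have := cdiff_bounds 0 (ang s) (theta y); rewrite add0r.
have := ang_cdiff 0 s (theta y).
set r := cdiff _ _ _ => ht /andP[r0 r1].
pose val01 (u : I) : R := \val u.
pose f (u : I) := k (ang ((1 - val01 u) * s + val01 u * (s + r)),
  conv (eta x) (eta y) (val01 u)).
have cv : continuous val01 by exact: continuous_valI.
have val01E u : 0 <= val01 u <= 1 by exact: I01_bounds.
have cst_c (T : topologicalType) (a : T) : continuous (fun _ : I => a).
  by move=> z; exact: cst_continuous.
have cf : continuous f.
  apply: continuous_compf ck; apply: continuous_pairf.
    exact: continuous_compf (line_continuous (cst_c R s) (cst_c R (s + r)) cv)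
      (@ang_continuous R).
  exact: continuous_compf (continuous_pairf (continuous_pairf
    (cst_c _ (eta x)) (cst_c _ (eta y))) cv) conv_cont.
have finj : injective f.
  move=> u v /(can_inj kK)[uv1 uv2]; apply: val_inj.
  have [exy|] := pselect (eta x = eta y); last first.
    by move=> ne; exact: (conv_inj ne uv2).
  have {}r0 : 0 < r.
    rewrite lt_def r0 andbT; apply/eqP => r00; apply: xy.
    by rewrite -(kE x) -(kE y) exy -ht r00 addr0 hs.
  have [n En] := ang_eq uv1.
  have /andP[u0 u1] : 0 <= val01 u <= 1 := val01E u.
  have /andP[v0 v1] : 0 <= val01 v <= 1 := val01E v.
  have nE : n%:~R = (val01 v - val01 u) * r 
    by apply: (addrI ((1 - val01 u) * s + val01 u * (s + r))); rewrite -En; ring.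
  have n0 : n = 0.
    apply: (@intr_lt1 R); rewrite nE normrM (gtr0_norm r0) (le_lt_trans _ r1)//.
    have vu : `|val01 v - val01 u| <= 1.
      by rewrite ler_norml; apply/andP; split; lra.
    exact: ler_piMl (ltW r0) vu.
  move: nE; rewrite n0 => /esym/eqP; rewrite mulf_eq0 (gt_eqF r0) orbF subr_eq0.
  by move=> /eqP/esym.
have [||p pE] := @path_of_fun R X x y f cf.
- by rewrite /f /val01 val_zeroI subr0 mul1r mul0r addr0 conv0 hs kE.
- by rewrite /f /val01 val_oneI subrr mul1r mul0r add0r conv1 ht kE.
exists p; rewrite (_ : (p : I -> X) = f); last exact/funext.
apply: compact_injective_embedding => //; exact: compact_I01.
Qed.

End circle_times_convex.

(** * The space of antiperiodic functions *)

Section antiperiodic_convex.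
Variable R : realType.
Local Notation E := (antiperiodic R).
Implicit Types (u w : E) (s t : R).

Let ap_conv_ex u w (t : R) : exists v, apfun v =
  fun s => (1 - t) * apfun u s + t * apfun w s.
Proof.
apply: apfun_ex => [|s]; last by rewrite !apfunD1; ring.
by apply: line_continuous;
  [exact: apfun_cont|exact: apfun_cont|move=> z; exact: cst_continuous].
Qed.

Definition ap_conv u w t : E := xget u [set v | apfun v =
  fun s => (1 - t) * apfun u s + t * apfun w s].

Lemma ap_convE u w t s :
  apfun (ap_conv u w t) s = (1 - t) * apfun u s + t * apfun w s.
Proof. by rewrite (xgetPex u (ap_conv_ex u w t)). Qed.

Lemma ap_conv0 u w : ap_conv u w 0 = u.
Proof. by apply: apfun_inj => s; rewrite ap_convE; ring. Qed.

Lemma ap_conv1 u w : ap_conv u w 1 = w.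
Proof. by apply: apfun_inj => s; rewrite ap_convE; ring. Qed.

Lemma ap_convxx u t : ap_conv u u t = u.
Proof. by apply: apfun_inj => s; rewrite ap_convE; ring. Qed.

Lemma ap_conv_inj u w s t : u <> w -> ap_conv u w s = ap_conv u w t -> s = t.
Proof.
move=> uw st; apply: contrapT => nst; apply: uw; apply: apfun_inj => z.
have := congr1 (fun v : E => apfun v z) st; rewrite !ap_convE => h.
have : (s - t) * (apfun w z - apfun u z) = 0.
  by apply: (addrI ((1 - t) * apfun u z + t * apfun w z)); rewrite addr0 -[in RHS]h; ring.
by move/eqP; rewrite mulf_eq0 !subr_eq0 => /orP[/eqP//|/eqP].
Qed.

Lemma ap_conv_cont : continuous (fun z : (E * E) * R => ap_conv z.1.1 z.1.2 z.2).
Proof.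
move=> [[u w] t] P /nbhs_apP[e e0 eP].
have [B B0 hu] := apfun_bounded u; have [C C0 hw] := apfun_bounded w.
(* Once [d <= 1], [T] bounds the sum of the norms of the perturbed coefficients [1 - t'] and [t'];
   [B] and [C] account for the change of [t] itself. *)
pose T := `|1 - t| + `|t| + 2; pose d := Num.min 1 (e / (T + B + C)).
have T0 : 0 < T by rewrite ltr_wpDl ?addr_ge0.
have TBC : 0 < T + B + C by lra.
have d0 : 0 < d by rewrite lt_min ltr01 divr_gt0.
exists ([set z | (forall s, `|apfun u s - apfun z.1 s| < d) /\
    (forall s, `|apfun w s - apfun z.2 s| < d)], ball t d).
  split; last exact: nbhsx_ballx.
  exists ([set u' | forall s, `|apfun u s - apfun u' s| < d],
    [set w' | forall s, `|apfun w s - apfun w' s| < d]); last by [].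
  by split; apply/nbhs_apP; exists d.
move=> [[u' w'] t'] /= [[uu' ww']]; rewrite /ball /= => tt'.
apply: eP => s; rewrite !ap_convE.
have {}uu' := uu' s; have {}ww' := ww' s; have {}hu := hu s; have {}hw := hw s.
move: uu' ww' hu hw; move: (apfun u s) (apfun w s) (apfun u' s) (apfun w' s).
move=> a b a' b' aa' bb' aB bC.
have -> : (1 - t) * a + t * b - ((1 - t') * a' + t' * b') =
  (1 - t') * (a - a') + t' * (b - b') + (t' - t) * a + (t - t') * b by ring.
have d1 : d <= 1 by rewrite ge_min lexx.
have dT : d * (T + B + C) <= e by rewrite -ler_pdivlMr// ge_min lexx orbT.
apply: (lt_le_trans _ dT).
have n1 : `|1 - t'| <= `|1 - t| + 1.
  have -> : 1 - t' = (1 - t) + (t - t') by ring.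
  by rewrite (le_trans (ler_normD _ _))// lerD2l (le_trans (ltW tt')).
have n2 : `|t'| <= `|t| + 1.
  rewrite -[t'](subrK t) (le_trans (ler_normD _ _))// addrC lerD2l distrC.
  by rewrite (le_trans (ltW tt')).
apply: (@le_lt_trans _ _ (`|1 - t'| * `|a - a'| + `|t'| * `|b - b'| +
    `|t' - t| * `|a| + `|t - t'| * `|b|)).
  rewrite -!normrM !(le_trans (ler_normD _ _))// lerD2r.
  by rewrite !(le_trans (ler_normD _ _))// lerD2r ler_normD.
rewrite (distrC t' t).
have m1 : `|1 - t'| * `|a - a'| <= (`|1 - t| + 1) * d by rewrite ler_pM// ltW.
have m2 : `|t'| * `|b - b'| <= (`|t| + 1) * d by rewrite ler_pM// ltW.
have m3 : `|t - t'| * `|a| <= d * B by rewrite ler_pM// ltW.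
have m4 : `|t - t'| * `|b| < d * C.
  by rewrite (@le_lt_trans _ _ (`|t - t'| * C)) ?ler_wpM2l// ltr_pM2r.
have -> : d * (T + B + C) = (`|1 - t| + 1) * d + (`|t| + 1) * d + d * B + d * C.
  by rewrite /T; ring.
by rewrite ler_ltD// !lerD.
Qed.

Lemma ap_hausdorff : hausdorff_space E.
Proof.
move=> u w uw; apply: apfun_inj => t; apply/eqP; rewrite -subr_eq0 -normr_eq0.
apply/negPn/negP => d0; pose e := `|apfun u t - apfun w t| / 2.
have e0 : 0 < e by rewrite divr_gt0// lt_def d0 /=.
have [||v [/= h1 h2]] := uw [set v | forall t, `|apfun u t - apfun v t| < e]
  [set v | forall t, `|apfun w t - apfun v t| < e].
- by apply/nbhs_apP; exists e.
- by apply/nbhs_apP; exists e.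
have : `|apfun u t - apfun w t| < e + e.
  have -> : apfun u t - apfun w t = (apfun u t - apfun v t) - (apfun w t - apfun v t) by ring.
  by rewrite (le_lt_trans (ler_normB _ _))// ltrD.
by rewrite -splitr ltxx.
Qed.

End antiperiodic_convex.

(** * Homeomorphisms obtained from relations, and separation of the spaces *)

Section homeomorphic.

Lemma homeomorphic_sym (X Y : topologicalType) :
  homeomorphic X Y -> homeomorphic Y X.
Proof. by move=> [h [k [? ? ? ?]]]; exists k, h. Qed.

Lemma homeomorphic_trans (X Y Z : topologicalType) :
  homeomorphic X Y -> homeomorphic Y Z -> homeomorphic X Z.
Proof.
move=> [h [k [hK kK ch ck]]] [h' [k' [hK' kK' ch' ck']]].
exists (h' \o h), (k \o k'); split.
- exact: can_comp.
- exact: can_comp.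
- exact: continuous_compf ch ch'.
- exact: continuous_compf ck' ck.
Qed.

(* Taking [x' = x] in the first continuity hypothesis shows that [y] is
   determined by [x] up to topological indistinguishability. *)
Lemma homeomorphic_of_rel (X Y : topologicalType) (Rel : X -> Y -> Prop) :
  (forall x, exists y, Rel x y) -> (forall y, exists x, Rel x y) ->
  (forall x x', (forall U : set X, nbhs x U -> U x') -> x = x') ->
  (forall y y', (forall V : set Y, nbhs y V -> V y') -> y = y') ->
  (forall x y, Rel x y -> forall V : set Y, nbhs y V ->
     \forall x' \near x, forall y', Rel x' y' -> V y') ->
  (forall x y, Rel x y -> forall U : set X, nbhs x U ->
     \forall y' \near y, forall x', Rel x' y' -> U x') ->
  homeomorphic X Y.
Proof.
move=> /choice[h hR] /choice[k kR] sX sY cX cY.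
have uY x y : Rel x y -> h x = y.
  move=> xy; apply: sY => V hV.
  exact: (nbhs_singleton (cX _ _ (hR x) _ hV)).
have uX x y : Rel x y -> k y = x.
  move=> xy; apply: sX => U kU.
  exact: (nbhs_singleton (cY _ _ (kR y) _ kU)).
exists h, k; split=> [x|y|x V hV|y U kU].
- exact: uX.
- exact: uY.
- by apply: filterS (cX _ _ (hR x) _ hV) => x'; apply.
- by apply: filterS (cY _ _ (kR y) _ kU) => y'; apply.
Qed.

End homeomorphic.

Section separated.

Definition nbhs_separated (X : topologicalType) : Prop :=
  forall x x' : X, (forall U : set X, nbhs x U -> U x') -> x = x'.

Lemma hausdorff_nbhs_separated (X : topologicalType) :
  hausdorff_space X -> nbhs_separated X.
Proof.
move=> hX x x' h; apply: hX => A B xA x'B; exists x'.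
by split; [exact: h|exact: nbhs_singleton].
Qed.

Lemma prod_nbhs_separated (X Y : topologicalType) :
  nbhs_separated X -> nbhs_separated Y -> nbhs_separated (X * Y)%type.
Proof.
move=> sX sY [x y] [x' y'] h; congr pair.
  by apply: sX => U xU; exact: (h _ (@cvg_fst _ _ (nbhs x) (nbhs y) _ U xU)).
by apply: sY => U yU; exact: (h _ (@cvg_snd _ _ (nbhs x) (nbhs y) _ U yU)).
Qed.

Lemma C1_sub_nbhs_separated (R : realType) (S : set (C1map R)) :
  nbhs_separated S.
Proof.
move=> f g h; apply: val_inj; apply: C1_close_sep => e e0.
by apply: (h [set g | C1_close e (\val f) (\val g)]); apply/nbhs_C1_subP; exists e.
Qed.

Lemma torus_minus_diag_hausdorff (R : realType) :
  hausdorff_space (torus_minus_diag R).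
Proof.
have cv : continuous (\val : torus_minus_diag R -> circle R * circle R).
  exact: initial_continuous.
apply: (injective_hausdorff cv val_inj).
by apply: prod_hausdorff; exact: circle_hausdorff.
Qed.

End separated.

(** * The logistic function, the logarithm and the alternating sign *)

Section estimates.
Variable R : realType.

Definition logistic (a : R) : R := (1 + expR (- a))^-1.
Definition logit (r : R) : R := - ln (r^-1 - 1).

Lemma logistic_gt0 a : 0 < logistic a.
Proof. by rewrite invr_gt0 ltr_wpDl// expR_gt0. Qed.

Lemma logistic_lt1 a : logistic a < 1.
Proof. by rewrite invf_lt1 ?ltrDl ?expR_gt0// ltr_wpDl// expR_gt0. Qed.

Lemma logisticK : cancel logistic logit.
Proof. by move=> a; rewrite /logit invrK addrC addKr expRK opprK. Qed.

Lemma logitK r : 0 < r < 1 -> logistic (logit r) = r.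
Proof.
move=> /andP[r0 r1]; rewrite /logistic opprK lnK ?posrE ?subr_gt0 ?invf_gt1//.
by rewrite addrC subrK invrK.
Qed.

Lemma logistic_cont : continuous logistic.
Proof.
move=> a; apply: (@continuousV _ _ (fun a => 1 + expR (- a))).
  by rewrite gt_eqF// ltr_wpDl// expR_gt0.
apply: (@continuousD R R R (cst 1)); first exact: cst_continuous.
have cN : continuous (fun a : R => - a) by move=> x; exact: (@continuousN R R R id).
exact: (continuous_compf cN (@continuous_expR R)).
Qed.

Lemma logit_cont r : 0 < r < 1 -> {for r, continuous logit}.
Proof.
move=> /andP[r0 r1]; apply: (@continuousN R R^o R).
apply: (@continuous_comp R R R (fun r => r^-1 - 1) (@ln R)); last first.
  by apply: continuous_ln; rewrite subr_gt0 invf_gt1.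
apply: (@continuousB R R R (@GRing.inv R) (cst 1)); last exact: cst_continuous.
by apply: inv_continuous; rewrite gt_eqF.
Qed.

(** Away from 0 a small difference is a small relative error, which reduces the claim to continuity
    of [ln] at 1. *)
Lemma ln_unif_cont (m e : R) : 0 < m -> 0 < e -> exists2 d : R, 0 < d &
  forall x y, m <= x -> `|x - y| < d -> 0 < y /\ `|ln x - ln y| < e.
Proof.
move=> m0 e0; have [d d0 hd] := continuousR_lt (continuous_ln ltr01) e0.
(* The 1 in the minimum keeps [y / x], and so [y], positive. *)
exists (m * Num.min 1 d); first by rewrite mulr_gt0// lt_min ltr01.
move=> x y mx xy; have x0 : 0 < x := lt_le_trans m0 mx.
have h : `|1 - y / x| < Num.min 1 d.
  have -> : 1 - y / x = (x - y) / x by rewrite mulrBl divff ?gt_eqF.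
  rewrite normrM normfV (gtr0_norm x0) ltr_pdivrMr// mulrC (lt_le_trans xy)//.
  by rewrite ler_wpM2r// le_min ler01 ltW.
move: h; rewrite lt_min => /andP[h1 /hd]; rewrite ln1 sub0r normrN => h2.
have yx : 0 < y / x by move: h1; rewrite ltr_norml => /andP[_]; lra.
have y0 : 0 < y by rewrite -(pmulr_lgt0 _ (_ : 0 < x^-1)) ?invr_gt0.
by split=> //; rewrite distrC -ln_div ?posrE.
Qed.

Lemma expR_near0 (e : R) : 0 < e -> exists2 d : R, 0 < d &
  forall z, `|z| < d -> `|expR z - 1| < e.
Proof.
move=> e0; have [d d0 hd] := continuousR_lt (@continuous_expR R 0) e0.
by exists d => // z zd; rewrite distrC -expR0 hd// sub0r normrN.
Qed.

End estimates.

Section sign_twist.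
Variable R : realType.

Definition alt_sign (t : R) : R := (-1) ^ (Num.floor t).

Lemma alt_signD1 t : alt_sign (t + 1) = - alt_sign t.
Proof.
rewrite /alt_sign -[t + 1]/(t + 1%:~R) floorDrz ?intr_int// intrKfloor.
by rewrite expfzDr ?oppr_eq0 ?oner_eq0// expr1z mulrN1.
Qed.

Lemma alt_sign_sqr t : alt_sign t * alt_sign t = 1.
Proof. by rewrite /alt_sign -expfzMl mulrNN mulr1 exp1rz. Qed.

Lemma norm_alt_sign t : `|alt_sign t| = 1.
Proof.
apply/eqP; rewrite -sqrp_eq1//; apply/eqP.
by rewrite -normrX expr2 alt_sign_sqr normr1.
Qed.

(** The sign jumps only at integers, where the zeros of [v] absorb the jump. *)
Lemma alt_sign_twist_cont (v : R -> R) : continuous v ->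
  (forall n : int, v n%:~R = 0) -> continuous (fun t => alt_sign t * v t).
Proof.
move=> cv v0 t; have /andP[t0 t1] := frac_bounds t; set n := Num.floor t in t0 t1.
have [tn|tn] := eqVneq t n%:~R.
  apply/cvgrPdist_lt => e e0; rewrite tn v0 mulr0.
  have [d d0 hd] := continuousR_lt (cv n%:~R) e0.
  apply/near_dist; exists d => // y ny; rewrite sub0r normrN normrM norm_alt_sign mul1r.
  by have := hd y ny; rewrite v0 sub0r normrN.
have nt : n%:~R < t by rewrite lt_def tn -subr_ge0.
apply: (@near_eq_continuous _ _ (fun y => (-1) ^ n * v y)).
  near=> y; congr (_ ^ _ * _); apply/esym/floor_def; rewrite intrD.
  apply/andP; split; first by apply/ltW; near: y; apply: lt_nbhsr.
  by near: y; apply: lt_nbhsl; lra.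
by apply: (@continuousM R R (cst _)); [exact: cst_continuous|exact: cv].
Unshelve. all: by end_near. Qed.

End sign_twist.

(** * Pairs of points and diffeomorphisms *)

Section lifts_of_C1_maps.
Variable R : realType.
Local Notation circle := (circle R).
Implicit Types (f g : C1map R) (F G : R -> R).

Lemma C1map_ang_continuous f : continuous (fun t => f (ang t)).
Proof.
move=> t; have [l hl] := (C1_funP f).1 (ang t).
have [F dF fF] := is_circle_derive_ang hl.
apply: (@near_eq_continuous R circle (@ang R \o F)).
  by near=> u; symmetry; near: u.
by apply: continuous_comp; [exact: is_derive1_cont dF|exact: ang_continuous].
Unshelve. all: by end_near. Qed.

Lemma C1map_lift f s : f (ang 0) = ang s ->
  exists2 F, is_lift f F & F 0 = s.
Proof.
move=> fs; have [F [cF F0 FE]] := lift_exists (@C1map_ang_continuous f) fs.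
by exists F => //; split.
Qed.

Lemma lift_degree f F : is_lift f F ->
  exists d : int, forall t, F (t + 1) = F t + d%:~R.
Proof.
move=> [cF fF]; have [||t|d hd] := @lift_uniq R (fun t => F (t + 1)) F.
- suff cs : continuous (fun t : R => t + 1) by exact: (continuous_compf cs cF).
  by move=> t; apply: (@continuousD R R R id (cst 1)) => //; exact: cst_continuous.
- exact: cF.
- by rewrite -!fF -[t + 1]/(t + 1%:~R) angD.
- by exists d.
Qed.

(** Lifts of the same degree have a periodic difference. As it vanishes at 0, the mean value theorem
    over one period bounds it by the distance of the derivatives. *)
Lemma lift_C1_close f g F G (d : int) :
  is_lift f F -> is_lift g G ->
  (forall t, F (t + 1) = F t + d%:~R) -> (forall t, G (t + 1) = G t + d%:~R) ->
  F 0 = 0 -> G 0 = 0 ->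
  forall b : R, (forall t, `|circle_derive f (ang t) - circle_derive g (ang t)| < b) ->
  C1_close b f g.
Proof.
move=> fF gG Fd Gd F0 G0 b hb; split=> x; have [t <-] := ang_surj x; last exact: hb.
rewrite fF.2 gG.2; apply: circle_ball_ang.
have hD (u : R) : is_derive u 1 (fun t => F t - G t)
    (circle_derive f (ang u) - circle_derive g (ang u)).
  by apply: is_deriveB; exact: lift_is_derive.
have hp u : F (u + 1) - G (u + 1) = F u - G u by rewrite Fd Gd; ring.
have [n /andP[n0 n1]] := reduce_mod t (ltr01 : 0 < 1 :> R).
rewrite -(@periodicz R (fun u => F u - G u) 1 hp n t).
set u := t + _ in n0 n1 *.
have [c] := MVT_exists 0 u hD; rewrite F0 G0 !subr0 => ->.
rewrite normrM (ger0_norm n0) (le_lt_trans _ (hb c))//.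
by rewrite ler_piMr// ltW.
Qed.

(** The degree is positive by monotonicity. Were it greater than 1, the lift would reach 1 strictly
    inside the unit interval, at a second preimage of the point 0. *)
Lemma Diff0_lift f : Diff0 R f ->
  exists F, [/\ is_lift f F, F 0 = 0 & forall t, F (t + 1) = F t + 1].
Proof.
move=> [[g [fK gK]] f'0 f0].
have [F fF F0] := C1map_lift f0.
have [d Fd] := lift_degree fF; have FD := lift_is_derive fF.
have Fm := deriv_gt0_lt FD (fun t => f'0 (ang t)).
have F1 : F 1 = d%:~R by have := Fd 0; rewrite F0 !add0r.
have d0 : (0 < d)%R.
  have : F 0 < F 1 by rewrite Fm ltr01.
  by rewrite F0 F1 -[0]/(0%:~R) ltr_int.
exists F; split=> // t; rewrite Fd; congr (_ + _).
suff -> : d = 1 by [].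
apply/eqP; rewrite eq_le -gtz0_ge1 d0 andbT leNgt; apply/negP => d1.
have [||c] := @IVT R F 0 1 1 ler01.
- by apply: continuous_subspaceT; exact: fF.1.
- have {}d1 : 1 < F 1 by rewrite F1 -[1]/(1%:~R) ltr_int.
  by rewrite F0 ge_min le_max ler01 (ltW d1) orbT.
rewrite in_itv /= => /andP[c0 c1] Fc.
have : ang c = ang 0.
  by apply: (can_inj fK); rewrite !fF.2 Fc F0 -(angD 0 1) add0r.
move=> /esym/ang_eq[n cn]; rewrite add0r in cn.
have c0' : 0 < c by rewrite -Fm F0 Fc ltr01.
have c1' : c < 1 by rewrite -Fm Fc F1 -[1]/(1%:~R) ltr_int.
move: c0' c1'; rewrite cn -[1]/(1%:~R) ltr_int -[0]/(0%:~R) ltr_int.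
by rewrite gtz0_ge1 => h1 /(le_lt_trans h1); rewrite ltxx.
Qed.

Lemma lift_Diff0 f F : is_lift f F -> F 0 = 0 ->
  (forall t, F (t + 1) = F t + 1) -> (forall t, 0 < circle_derive f (ang t)) ->
  Diff0 R f.
Proof.
move=> fF F0 F1 f'0; have FD := lift_is_derive fF.
have [G [FK GK GD G1]] := quasiperiodic_inverse ltr01 ltr01 FD f'0 F1.
have cG : continuous G by move=> t; exact: is_derive1_cont (GD t).
have [|t|g [gG g'E]] := @C1map_of_lift R G _ 1 _ GD G1.
- move=> t; apply: (@continuousV _ _ (fun t => circle_derive f (ang (G t)))).
    by rewrite gt_eqF.
  exact: continuous_compf cG (@continuous_derive_ang R f) t.
- by rewrite G1 -[_ + 1]/(_ + 1%:~R) angD.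
split.
- exists g; split=> x; have [t <-] := ang_surj x.
    by rewrite fF.2 gG.2 FK.
  by rewrite gG.2 fF.2 GK.
- by move=> x; have [t <-] := ang_surj x.
- by rewrite fF.2 F0.
Qed.

End lifts_of_C1_maps.

Section torus_and_diffeos.
Variable R : realType.
Local Notation circle := (circle R).
Local Notation E := (antiperiodic R).
Local Notation TD := (torus_minus_diag R).
Local Notation D0 := (Diff0 R).

(** Distinctness excludes the value 0, the only one at which [cdiff 0] is discontinuous. *)
Lemma torus_minus_diag_gap (p : TD) :
  0 < cdiff 0 (\val p).1 (\val p).2 < 1.
Proof.
have := set_valP p; case: (\val p) => x y /= xy.
have := cdiff_bounds 0 x y; rewrite add0r => /andP[h0 ->]; rewrite andbT.
rewrite lt_def h0 andbT; apply/eqP => c0; apply: xy.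
have [s sx] := ang_surj x; have := ang_cdiff 0 s y.
by rewrite sx c0 addr0 sx.
Qed.

(* The gap between the two points gives [u 0]; the rest of [u] is the
   logarithmic derivative of the diffeomorphism, made antiperiodic by the
   alternating sign. *)
Definition diffeo_rel (z : TD * D0) (y : circle * E) : Prop :=
  [/\ (\val z.1).1 = y.1,
      cdiff 0 (\val z.1).1 (\val z.1).2 = logistic (apfun y.2 0)
    & forall t, apfun y.2 t = apfun y.2 0 * cos (pi * t) +
        alt_sign t * (ln (circle_derive (\val z.2) (ang t)) -
                      ln (circle_derive (\val z.2) (ang 0)))].

Lemma cos_pi_cont : continuous (fun t : R => cos (pi * t)).
Proof. exact: continuous_compf (@mulrl_continuous R pi) (@continuous_cos R). Qed.

Lemma cos_piD1 (t : R) : cos (pi * (t + 1)) = - cos (pi * t).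
Proof. by rewrite mulrDr mulr1 cosDpi. Qed.

Lemma diff0_derive_gt0 (f : D0) x : 0 < circle_derive (\val f) x.
Proof. by have [_ h _] := set_valP f; exact: h. Qed.

Lemma diffeo_rel_total (z : TD * D0) : exists y, diffeo_rel z y.
Proof.
case: z => p f; pose a := logit (cdiff 0 (\val p).1 (\val p).2).
pose l t := ln (circle_derive (\val f) (ang t)).
have cl : continuous (fun t => l t - l 0).
  move=> t; apply: (@continuousB R R R l (cst (l 0))); last exact: cst_continuous.
  apply: (@continuous_comp R R R (fun t => circle_derive (\val f) (ang t)) (@ln R)).
    exact: continuous_derive_ang.
  by apply: continuous_ln; exact: diff0_derive_gt0.
have l1 t : l (t + 1) = l t by rewrite /l -[t + 1]/(t + 1%:~R) angD.
have [||u uE] := @apfun_ex R (fun t => a * cos (pi * t) + alt_sign t * (l t - l 0)).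
- move=> t; apply: (@continuousD R R R (fun t => a * cos (pi * t))
    (fun t => alt_sign t * (l t - l 0))).
    by apply: (@continuousM R R (cst a)); [exact: cst_continuous|exact: cos_pi_cont].
  apply: alt_sign_twist_cont cl _ t => n.
  by have := periodicz l1 n 0; rewrite add0r mulr1 => ->; rewrite subrr.
- by move=> t; rewrite cos_piD1 alt_signD1 l1; ring.
have u0 : apfun u 0 = a by rewrite uE mulr0 cos0 subrr; ring.
exists ((\val p).1, u); split=> //=.
  by rewrite u0 logitK// torus_minus_diag_gap.
by move=> t; rewrite u0 uE.
Qed.

Lemma diffeo_rel_onto (y : circle * E) : exists z, diffeo_rel z y.
Proof.
case: y => x u; have [s sx] := ang_surj x.
have cg : cdiff 0 x (ang (s + logistic (apfun u 0))) = logistic (apfun u 0).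
  rewrite -sx cdiffE; first by ring.
  have := logistic_gt0 (apfun u 0); have := logistic_lt1 (apfun u 0).
  by move=> h1 h2; apply/andP; split; lra.
have pP : (x, ang (s + logistic (apfun u 0))) \in torus_minus_diag R.
  rewrite inE /torus_minus_diag /= /diagonal /= => xe.
  have := cg; rewrite -xe -sx cdiffE ?subrr; last by apply/andP; split; lra.
  by move=> h; have := logistic_gt0 (apfun u 0); rewrite -h ltxx.
(* Removing the cosine term leaves an antiperiodic function vanishing at 0, hence at all integers,
   so that the sign twist below is continuous. *)
pose w t := apfun u t - apfun u 0 * cos (pi * t).
have w1 t : w (t + 1) = - w t by rewrite /w apfunD1 cos_piD1; ring.
have w0 : w 0 = 0 by rewrite /w mulr0 cos0; ring.
have cw : continuous w.
  move=> t; apply: (@continuousB R R R (apfun u) (fun t => apfun u 0 * cos (pi * t))).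
    exact: apfun_cont.
  by apply: (@continuousM R R (cst (apfun u 0))); [exact: cst_continuous|exact: cos_pi_cont].
have wn (n : int) : w n%:~R = 0.
  have ww t : `|w (t + 1)| = `|w t| by rewrite w1 normrN.
  have := periodicz ww n 0; rewrite add0r mulr1 w0 normr0 => /eqP.
  by rewrite normr_eq0 => /eqP.
pose v t := alt_sign t * w t.
have cv : continuous v by exact: alt_sign_twist_cont.
have v1 t : v (t + 1) = v t by rewrite /v alt_signD1 w1 mulrNN.
have v0 : v 0 = 0 by rewrite /v w0 mulr0.
have cev : continuous (fun t => expR (v t)) by exact: continuous_compf cv (@continuous_expR R).
have [P P0 PD] := continuous_primitive cev.
have Pm := deriv_gt0_lt PD (fun t => expR_gt0 (v t)).
have P1 : 0 < P 1 by rewrite -P0 Pm ltr01.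
have Pp t : P (t + 1) = P t + P 1.
  have P1D (s' : R) : is_derive s' 1 (fun t => P (t + 1)) (expR (v s')).
    by rewrite -(v1 s'); exact: is_derive1_translate (PD _).
  have h (s' : R) : is_derive s' 1 ((fun t => P (t + 1)) - P) 0.
    by rewrite -(subrr (expR (v s'))); apply: is_deriveB.
  have hh : P (t + 1) - P t = P (0 + 1) - P 0 by exact: is_derive_0_is_cst t 0 h.
  by rewrite -[LHS](subrK (P t)) hh add0r P0; ring.
(* Dividing by [P 1] makes the lift gain 1 over a period. It adds a constant to the logarithmic
   derivative, which the normalization at 0 cancels. *)
pose H t := (P 1)^-1 * P t.
have HD (t : R) : is_derive t 1 H ((P 1)^-1 * expR (v t)).
  exact: (@is_deriveZ R R R P (P 1)^-1 t 1).
have [|||f [fH f'E]] := @C1map_of_lift R _ _ 1 _ HD.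
- move=> t; apply: (@continuousM R R (cst (P 1)^-1) (fun t => expR (v t))); last exact: cev.
  exact: cst_continuous.
- by move=> t; rewrite /H Pp mulrDr mulVf// gt_eqF.
- by move=> t; rewrite v1.
have fP : f \in Diff0 R.
  rewrite inE; apply: lift_Diff0 fH _ _ _.
  - by rewrite /H P0 mulr0.
  - by move=> t; rewrite /H Pp mulrDr mulVf// gt_eqF.
  - by move=> t; rewrite f'E mulr_gt0 ?invr_gt0 ?expR_gt0.
exists (SigSub pP, SigSub fP); split=> //= t.
rewrite !f'E !lnM ?posrE ?invr_gt0 ?expR_gt0// !expRK v0 /v.
have := alt_sign_sqr t; set b := alt_sign t => bb.
have -> : b * (ln (P 1)^-1 + b * w t - (ln (P 1)^-1 + 0)) = (b * b) * w t by ring.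
by rewrite bb /w; ring.
Qed.

End torus_and_diffeos.

Section torus_and_diffeos_homeomorphism.
Variable R : realType.
Local Notation circle := (circle R).
Local Notation E := (antiperiodic R).
Local Notation TD := (torus_minus_diag R).
Local Notation D0 := (Diff0 R).

Lemma nbhs_circle_apP (y : circle * E) (V : set (circle * E)) :
  nbhs y V <-> exists2 e : R, 0 < e & forall y', ball y.1 e y'.1 ->
    (forall t, `|apfun y.2 t - apfun y'.2 t| < e) -> V y'.
Proof.
case: y => x u; split=> [[[A B] /= [/nbhs_ballP[a a0 aA] /nbhs_apP[b b0 bB]] ABV]|].
  exists (Num.min a b); first by rewrite lt_min a0.
  move=> [x' u'] /= xx' uu'; apply: (ABV (x', u')); split=> /=.
    by apply: aA; apply: le_ball xx'; rewrite ge_min lexx.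
  by apply: bB => t; rewrite (lt_le_trans (uu' t))// ge_min lexx orbT.
move=> [e e0 eV].
exists (ball x e, [set u' | forall t, `|apfun u t - apfun u' t| < e]).
  by split; [exact: nbhsx_ballx|apply/nbhs_apP; exists e].
by move=> [x' u'] /= [xx' uu']; exact: eV.
Qed.

Lemma norm_cos_le1 (t : R) : `|cos t| <= 1.
Proof. by rewrite ler_norml cos_geN1 cos_le1. Qed.

Lemma diffeo_rel_continuous (z : TD * D0) (y : circle * E) : diffeo_rel z y ->
  forall V, nbhs y V -> \forall z' \near z, forall y', diffeo_rel z' y' -> V y'.
Proof.
case: z => p f [/= xE gE uE] V /nbhs_circle_apP[e e0 eV].
pose gap (q : circle * circle) := logit (cdiff 0 q.1 q.2).
have /andP[g0 g1] := torus_minus_diag_gap p.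
(* Three errors of this size occur: one from the gap, and one from the logarithmic derivative at
   each of [t] and 0. *)
have e4 : 0 < e / 4 by exact: divr_gt0.
have cgap : {for \val p, continuous gap}.
  apply: (@continuous_comp _ R R (fun q => cdiff 0 q.1 q.2) (@logit R)).
    by case: (\val p) g0 => a b /= g0; apply: cdiff_continuous; rewrite gt_eqF.
  by apply: logit_cont; rewrite g0.
have /= Np : \forall q \near \val p, `|gap (\val p) - gap q| < e / 4.
  by move/cvgrPdist_lt : cgap; apply.
have Nx : \forall q \near \val p, ball (\val p).1 e q.1.
  by apply: (@continuous_fst _ _ (\val p)); exact: nbhsx_ballx.
have [m m0 hm] : exists2 m : R, 0 < m & forall t, m <= circle_derive (\val f) (ang t).
  apply: (@periodic_pos_lb R _ 1 ltr01).
  - by move=> t; rewrite -[t + 1]/(t + 1%:~R) angD.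
  - exact: continuous_derive_ang.
  - by move=> t; exact: diff0_derive_gt0.
have [d d0 hd] := ln_unif_cont m0 e4.
exists ([set q : TD | `|gap (\val p) - gap (\val q)| < e / 4 /\
    ball (\val p).1 e (\val q).1],
  [set g : D0 | C1_close d (\val f) (\val g)]).
  split; last by apply/nbhs_C1_subP; exists d.
  apply/nbhs_set_typeP; exists [set q | `|gap (\val p) - gap q| < e / 4 /\
    ball (\val p).1 e q.1] => //.
  exact: filterI.
move=> [q g] /= [[gq xq] [_ fg]] [x1 u1] [/= xE1 gE1 uE1].
apply: eV => /= [|t]; first by rewrite -xE -xE1.
have u0 : `|apfun y.2 0 - apfun u1 0| < e / 4.
  by move: gq; rewrite /gap gE gE1 !logisticK.
have lt (t' : R) : `|ln (circle_derive (\val f) (ang t')) -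
    ln (circle_derive (\val g) (ang t'))| < e / 4.
  by have [] := hd _ _ (hm t') (fg (ang t')).
rewrite uE uE1.
have -> : apfun y.2 0 * cos (pi * t) + alt_sign t *
     (ln (circle_derive (\val f) (ang t)) - ln (circle_derive (\val f) (ang 0))) -
   (apfun u1 0 * cos (pi * t) + alt_sign t *
     (ln (circle_derive (\val g) (ang t)) - ln (circle_derive (\val g) (ang 0)))) =
   (apfun y.2 0 - apfun u1 0) * cos (pi * t) + alt_sign t *
     ((ln (circle_derive (\val f) (ang t)) - ln (circle_derive (\val g) (ang t))) -
     (ln (circle_derive (\val f) (ang 0)) - ln (circle_derive (\val g) (ang 0)))) by ring.
apply: (@le_lt_trans _ _ (e / 4 + (e / 4 + e / 4))); last by lra.
rewrite (le_trans (ler_normD _ _))// lerD//.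
  by rewrite normrM (le_trans (ler_piMr _ (norm_cos_le1 _)))// ltW.
rewrite normrM norm_alt_sign mul1r (le_trans (ler_normB _ _))//.
by rewrite lerD// ltW.
Qed.

Lemma diffeo_rel_continuousV (z : TD * D0) (y : circle * E) : diffeo_rel z y ->
  forall U, nbhs z U -> \forall y' \near y, forall z', diffeo_rel z' y' -> U z'.
Proof.
case: z y => p f [x u] [/= xE gE uE] U [[A B] /= [pA fB] ABU].
have [Q pQ QA] := (nbhs_set_typeP _ _).1 pA.
have [b b0 hb] := (nbhs_C1_subP _ _).1 fB.
have [[Q1 Q2] /= [q1 q2] Q12] : nbhs ((\val p).1, (\val p).2) Q.
  by case: (\val p) pQ.
move/nbhs_ballP : q1 => [c1 c10 hc1]; move/nbhs_ballP : q2 => [c2 c20 hc2].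
have c22 : 0 < c2 / 2 by exact: divr_gt0.
have [d1 d10 hd1] := continuousR_lt (@logistic_cont R (apfun u 0)) c22.
have [C C0 hC] := @periodic_bounded R (fun t => circle_derive (\val f) (ang t)) 1
  ltr01 (fun t => congr1 (circle_derive (\val f)) (angD t 1))
  (@continuous_derive_ang R (\val f)).
have bC : 0 < b / C by exact: divr_gt0.
have [d2 d20 hd2] := expR_near0 bC.
apply/nbhs_circle_apP.
(* The logarithmic derivatives normalized at 0 will differ by less than [2 * (d2 / 5)]; using this
   at two points keeps the total below [d2]. *)
exists (Num.min (Num.min c1 (c2 / 2)) (Num.min d1 (d2 / 5))).
  by rewrite !lt_min c10 c22 d10 divr_gt0.
move=> [x1 u1] /= xx1 uu1 [[[a1 a2] qP] g] [/= xE1 ga uE1].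
rewrite {a1}xE1 in qP ga *.
have ux t : `|apfun u t - apfun u1 t| < d1 /\ `|apfun u t - apfun u1 t| < d2 / 5.
  by have := uu1 t; rewrite !lt_min => /andP[_ /andP[]].
apply: (ABU (_, g)); split=> /=.
  apply: QA => /=; apply: (Q12 (x1, a2)); split=> /=.
    apply: hc1; rewrite xE; apply: le_ball xx1.
    by rewrite !ge_min lexx.
  apply: hc2; have [s sx] := ang_surj x.
  move: xx1; rewrite -sx => /circle_ballP[s1 s1x]; rewrite !lt_min => /andP[/andP[_ ss1] _].
  have -> : (\val p).2 = ang (s + logistic (apfun u 0)).
    by rewrite -gE xE -sx ang_cdiff.
  have -> : a2 = ang (s1 + logistic (apfun u1 0)).
    by rewrite -ga -s1x ang_cdiff.
  apply: circle_ball_ang.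
  have -> : s + logistic (apfun u 0) - (s1 + logistic (apfun u1 0)) =
    (s - s1) + (logistic (apfun u 0) - logistic (apfun u1 0)) by ring.
  rewrite (le_lt_trans (ler_normD _ _))// [c2]splitr ltrD//.
  exact: hd1 (ux 0).1.
apply: hb.
have [F [fF F0 F1]] := Diff0_lift (set_valP f).
have [G [gG G0 G1]] := Diff0_lift (set_valP g).
apply: (lift_C1_close (d := 1) fF gG F1 G1 F0 G0).
pose l t := ln (circle_derive (\val f) (ang t)).
pose k t := ln (circle_derive (\val g) (ang t)).
have lw t : l t - l 0 = alt_sign t * (apfun u t - apfun u 0 * cos (pi * t)).
  by rewrite uE [in RHS]addrAC subrr add0r mulrA alt_sign_sqr mul1r.
have kw t : k t - k 0 = alt_sign t * (apfun u1 t - apfun u1 0 * cos (pi * t)).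
  by rewrite uE1 [in RHS]addrAC subrr add0r mulrA alt_sign_sqr mul1r.
have lk t : `|(k t - k 0) - (l t - l 0)| < 2 * (d2 / 5).
  rewrite kw lw -mulrBr normrM norm_alt_sign mul1r distrC.
  have -> : apfun u t - apfun u 0 * cos (pi * t) - (apfun u1 t - apfun u1 0 * cos (pi * t))
    = (apfun u t - apfun u1 t) - (apfun u 0 - apfun u1 0) * cos (pi * t) by ring.
  rewrite (le_lt_trans (ler_normB _ _))// (_ : 2 * (d2 / 5) = d2 / 5 + d2 / 5); last by ring.
  rewrite ltr_leD ?(ux t).2//.
  by rewrite normrM (le_trans (ler_piMr _ (norm_cos_le1 _)))// ltW// (ux 0).2.
(* So far the logarithmic derivatives are compared only up to their values at 0. Both lifts gain 1
   over a period, so their derivatives agree at some [tau], which recovers the missing constant. *)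
have [tau ktau] : exists tau, k tau = l tau.
  have hD (t : R) : is_derive t 1 (F - G)
      (circle_derive (\val f) (ang t) - circle_derive (\val g) (ang t)).
    by apply: is_deriveB; exact: lift_is_derive.
  have [tau] := MVT_exists 0 1 hD.
  rewrite subr0 mulr1 !fctE => h; exists tau.
  have F1' : F 1 = 1 by have := F1 0; rewrite F0 !add0r.
  have G1' : G 1 = 1 by have := G1 0; rewrite G0 !add0r.
  move: h; rewrite F1' G1' F0 G0 !subrr => /esym/eqP.
  by rewrite subr_eq0 /k /l => /eqP ->.
have kl t : `|k t - l t| < d2.
  have -> : k t - l t = (k t - k 0 - (l t - l 0)) - (k tau - k 0 - (l tau - l 0)).
    by rewrite ktau; ring.
  rewrite (le_lt_trans (ler_normB _ _))//.
  by have h1 := lk t; have h2 := lk tau; lra.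
move=> t; have fE : circle_derive (\val f) (ang t) = expR (l t).
  by rewrite lnK// posrE diff0_derive_gt0.
have gE' : circle_derive (\val g) (ang t) = expR (k t).
  by rewrite lnK// posrE diff0_derive_gt0.
have -> : circle_derive (\val f) (ang t) - circle_derive (\val g) (ang t) =
  - (circle_derive (\val f) (ang t) * (expR (k t - l t) - 1)).
  by rewrite fE gE' expRD expRN; field; rewrite gt_eqF ?expR_gt0.
have fC : `|circle_derive (\val f) (ang t)| <= C by exact: hC.
rewrite normrN normrM (le_lt_trans (ler_wpM2r (normr_ge0 _) fC))//.
by rewrite mulrC -ltr_pdivlMr//; apply: hd2.
Qed.

Lemma torus_diffeos_homeomorphic : homeomorphic (TD * D0)%type (circle * E)%type.
Proof.
apply: (@homeomorphic_of_rel _ _ (@diffeo_rel R)).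
- exact: diffeo_rel_total.
- exact: diffeo_rel_onto.
- apply: prod_nbhs_separated; last exact: C1_sub_nbhs_separated.
  exact: hausdorff_nbhs_separated (@torus_minus_diag_hausdorff R).
- apply: hausdorff_nbhs_separated; apply: prod_hausdorff.
    exact: circle_hausdorff.
  exact: ap_hausdorff.
- exact: diffeo_rel_continuous.
- exact: diffeo_rel_continuousV.
Qed.

End torus_and_diffeos_homeomorphism.

(** * Maps preserving the Lebesgue measure *)

Section lebesgue_preimage.
Variables (R : realType) (f : R -> R).
Hypothesis cf : continuous f.
Local Notation RR := (measurableTypeR R).
Local Notation mu := (@lebesgue_measure R).

Lemma continuous_preimage_measurable (A : set RR) :
  measurable A -> measurable (f @^-1` A : set RR).
Proof.
by move=> mA; rewrite -[X in measurable X]setTI; exact: continuous_measurable_fun.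
Qed.

(* The continuity proof is an argument so that the measure structure can be
   inferred. *)
Definition lebesgue_preimage (_ : continuous f) : set RR -> \bar R :=
  pushforward mu (f : RR -> RR).

Let lebesgue_preimage0 : lebesgue_preimage cf set0 = 0%E.
Proof. by rewrite /lebesgue_preimage /pushforward preimage_set0 measure0. Qed.

Let lebesgue_preimage_ge0 A : (0 <= lebesgue_preimage cf A)%E.
Proof. by rewrite /lebesgue_preimage /pushforward; apply: measure_ge0. Qed.

Let lebesgue_preimage_sigma_additive : semi_sigma_additive (lebesgue_preimage cf).
Proof.
move=> F mF tF mUF; rewrite /lebesgue_preimage /pushforward preimage_bigcup.
apply: measure_semi_sigma_additive.
- by move=> n; exact: continuous_preimage_measurable.
- apply/trivIsetP => i j _ _ ij; rewrite -preimage_setI.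
  by move/trivIsetP : tF => /(_ _ _ _ _ ij) ->//; rewrite preimage_set0.
- by rewrite -preimage_bigcup; exact: continuous_preimage_measurable.
Qed.

HB.instance Definition _ := isMeasure.Build _ _ _ (lebesgue_preimage cf)
  lebesgue_preimage0 lebesgue_preimage_ge0 lebesgue_preimage_sigma_additive.

End lebesgue_preimage.

Section lebesgue_preserving.
Variable R : realType.
Local Notation RR := (measurableTypeR R).
Local Notation mu := (@lebesgue_measure R).
Local Open Scope ereal_scope.

Lemma lebesgue_oc (a b : R) : (a <= b)%R -> mu `]a, b]%classic = (b - a)%:E.
Proof.
move=> ab; rewrite lebesgue_measure_itv /= lte_fin.
by case: ltgtP ab => // -> _; rewrite subrr.
Qed.

Lemma lebesgue_translate (c : R) (A : set RR) : measurable A ->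
  mu ((fun t => t + c)%R @^-1` A) = mu A.
Proof.
move=> mA; have cc : continuous (fun t : R => t + c)%R.
  by move=> t; apply: (@continuousD R R R id (cst c)) => //; exact: cst_continuous.
symmetry; apply: (@lebesgue_measure_unique R (lebesgue_preimage cc)) => //.
move=> X [[a b] _ <-] /=; rewrite /lebesgue_preimage /pushforward.
rewrite (_ : _ @^-1` _ = `](a - c)%R, (b - c)%R]%classic); last first.
  by apply/seteqP; split=> t /=; rewrite !in_itv /= ltrBlDr lerBrDr.
by rewrite !lebesgue_measure_itv /= !lte_fin ltrD2r; case: ifP => // _;
  rewrite -!EFinB; congr EFin; ring.
Qed.

(** The left-hand side is a measure in [A], so uniqueness of Lebesgue measure reduces the equality
    to half-open intervals. *)
Lemma lebesgue_preimage_add (f g : R -> R) : continuous f -> continuous g ->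
  (forall a b : R, (a <= b)%R ->
    mu (f @^-1` `]a, b]) + mu (g @^-1` `]a, b]) = (b - a)%:E) ->
  forall A : set RR, measurable A -> mu (f @^-1` A) + mu (g @^-1` A) = mu A.
Proof.
move=> cf cg fg A mA.
pose m := measure_add (lebesgue_preimage cf) (lebesgue_preimage cg).
have mE X : m X = mu (f @^-1` X) + mu (g @^-1` X) by exact: measure_addE.
rewrite -mE.
symmetry; apply: (@lebesgue_measure_unique R m) => //.
move=> X [[a b] _ <-]; rewrite -[RHS]/(m _) mE /=.
have [ab|/ltW ba] := leP a b; first by rewrite lebesgue_oc// -fg.
by rewrite set_itv_ge ?measure0 ?adde0// bnd_simp -leNgt.
Qed.

Lemma periodic_measure (S : set RR) (a : R) : measurable S ->
  (forall t, S (t + 1)%R <-> S t) ->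
  mu (S `&` `[a, (a + 1)%R[%classic) = mu (S `&` `[0%R, 1%R[%classic).
Proof.
move=> mS S1.
(* The indicator of [S] is a real periodic function, which makes [periodicz] available. *)
have Sn (n : int) t : S (t + n%:~R)%R <-> S t.
  have := @periodicz R (fun t => `[< S t >]%:R) 1 _ n t.
  rewrite mulr1 => h; have /h : forall t, `[< S (t + 1)%R >]%:R = `[< S t >]%:R :> R.
    by move=> u; congr (_%:R); congr nat_of_bool; exact/asbool_equiv_eq.
  case: asboolP; case: asboolP => //= _ _ /eqP; rewrite ?oner_eq0//.
  by rewrite eq_sym oner_eq0.
have mI (c d : R) : measurable (S `&` `[c, d[%classic).
  by apply: measurableI => //; exact: measurable_itv.
have shift (n : int) (c d : R) :
    mu (S `&` `[(c + n%:~R)%R, (d + n%:~R)%R[%classic) = mu (S `&` `[c, d[%classic).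
  rewrite -[in LHS](lebesgue_translate n%:~R) //; congr (mu _).
  apply/seteqP; split=> t /=; rewrite !in_itv /= => -[h1 h2].
    by rewrite Sn in h1; split=> //; move: h2; rewrite lerD2r ltrD2r.
  by rewrite Sn; split=> //; rewrite lerD2r ltrD2r.
have split3 (c d e : R) : (c <= d <= e)%R ->
    mu (S `&` `[c, e[%classic) = mu (S `&` `[c, d[%classic) + mu (S `&` `[d, e[%classic).
  move=> /andP[cd de]; rewrite -measureU//.
    rewrite -setIUr; congr (mu (S `&` _)); apply/seteqP; split=> t /=.
      rewrite !in_itv /= => /andP[h1 h2].
      by have [td|dt] := ltP t d; [left|right]; rewrite ?h1 ?h2.
    rewrite !in_itv /= => -[/andP[h1 h2]|/andP[h1 h2]].
      by rewrite h1 (lt_le_trans h2).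
    by rewrite h2 (le_trans cd).
  apply/seteqP; split=> t //= -[[_ +] [_ +]]; rewrite !in_itv /=.
  by move=> /andP[_ h1] /andP[h2 _]; have := lt_le_trans h1 h2; rewrite ltxx.
have [n] := reduce_mod a (ltr01 : 0 < 1 :> R)%R; rewrite mulr1.
set r := (a + _)%R => /andP[r0 r1].
(* With the left end moved to [r] in the unit interval, the window is cut at 1 and its right part is
   translated back to start at 0. *)
rewrite -(shift n a) addrAC -/r (split3 r 1%R) ?(ltW r1) ?lerDr//.
rewrite (split3 0%R r 1%R) ?r0 ?(ltW r1)// addeC.
by congr (_ + _); have := shift (Posz 1) 0%R r; rewrite add0r.
Qed.

End lebesgue_preserving.

Section circle_lebesgue_preserving.
Variable R : realType.
Local Notation RR := (measurableTypeR R).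
Local Notation mu := (@lebesgue_measure R).
Local Open Scope ereal_scope.

(** Dropping the null endpoint 1 leaves one representative per point of the circle, a fundamental
    domain for [periodic_measure]. *)
Lemma circle_lebesgueE (A : set (circle_borel R)) :
  measurable (@ang R @^-1` A : set RR) ->
  circle_lebesgue A = mu (@ang R @^-1` A `&` `[0%R, 1%R[%classic).
Proof.
move=> mA; rewrite /circle_lebesgue /pushforward /mrestr.
set S := _ @^-1` A.
have -> : S `&` `[0%R, 1%R]%classic =
    (S `&` `[0%R, 1%R[%classic) `|` (S `&` [set 1%R]).
  rewrite -setIUr; congr (_ `&` _); apply/seteqP; split=> t /=; rewrite !in_itv /=.
    by move=> /andP[-> ]; rewrite le_eqVlt => /predU1P[->|->]; [right|left].
  by move=> [/andP[-> /ltW//]|->]; rewrite ler01 lexx.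
have mS1 : measurable (S `&` [set 1%R] : set RR) by exact: measurableI.
rewrite measureU//.
- rewrite [X in _ + X](_ : _ = 0) ?adde0//.
  apply/eqP; rewrite eq_le measure_ge0 andbT -(lebesgue_measure_set1 (1 : R)%R).
  by apply: le_measure; rewrite ?inE//; exact: subIsetr.
- exact: measurableI.
- apply/seteqP; split=> t //= -[[_ h] [_ t1]].
  by move: h; rewrite t1 in_itv /= ltxx andbF.
Qed.

Lemma circle_borel_preimage (A : set (circle_borel R)) :
  measurable A -> measurable (@ang R @^-1` A : set RR).
Proof. by move=> mA; rewrite -[X in measurable X]setTI; exact: measurable_ang. Qed.

Section expanding.
Variables (f : circle R -> circle R) (F G : R -> R).
Hypotheses (cF : continuous F) (fF : forall t, f (ang t) = ang (F t)).
Hypotheses (FK : cancel F G) (GK : cancel G F) (Fm : {mono F : x y / (x < y)%R}).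
Hypothesis Gp : forall t, G (t + 2)%R = (G t + 1)%R.

Let Gm : {mono G : x y / (x < y)%R}.
Proof. by move=> x y; rewrite -Fm !GK. Qed.

Let Gle : {mono G : x y / (x <= y)%R}.
Proof. by apply: le_mono => x y; rewrite Gm. Qed.

Let Fp t : F (t + 1)%R = (F t + 2)%R.
Proof. by apply: (can_inj GK); rewrite Gp !FK. Qed.

Let cF1 : continuous (fun t => F t - 1)%R.
Proof.
by move=> t; apply: (@continuousB R R R F (cst 1%R)); [exact: cF|exact: cst_continuous].
Qed.

Let preimF (a b : R) : F @^-1` `]a, b]%classic = `]G a, G b]%classic.
Proof.
apply/seteqP; split=> t /=; rewrite !in_itv /=.
  by rewrite -(Fm (G a)) GK => /andP[-> h]; rewrite leNgt -Fm GK -leNgt.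
by rewrite -(Fm (G a)) GK => /andP[-> h]; rewrite leNgt -(GK b) Fm -leNgt.
Qed.

Let preimF1 (a b : R) : (fun t => F t - 1)%R @^-1` `]a, b]%classic =
  `]G (a + 1), G (b + 1)]%classic.
Proof.
rewrite -preimF; apply/seteqP; split=> t /=; rewrite !in_itv /=;
  by rewrite ltrBrDr lerBlDr.
Qed.

(** The period starting at [G 0] is mapped by [F] bijectively onto an interval of length 2. Cutting
    where [F] equals 1 separates the two inverse branches of [f]. *)
Lemma circle_lebesgue_preimage (A : set (circle_borel R)) : measurable A ->
  let T := @ang R @^-1` A `&` `[0%R, 1%R[%classic in
  circle_lebesgue (f @^-1` A) = mu (F @^-1` T) + mu ((fun t => F t - 1)%R @^-1` T).
Proof.
move=> mA T; have mS := circle_borel_preimage mA.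
set S := _ @^-1` A in T mS *.
have S1 t : S (t + 1)%R <-> S t by rewrite /S /= -[(t + 1)%R]/(t + 1%:~R)%R angD.
have SE : @ang R @^-1` (f @^-1` A) = F @^-1` S.
  by apply/seteqP; split=> t; rewrite /S /= fF.
have mFS : measurable (F @^-1` S : set RR) by exact: continuous_preimage_measurable.
have mT : measurable (T : set RR) by apply: measurableI => //; exact: measurable_itv.
rewrite circle_lebesgueE SE// -(@periodic_measure _ _ (G 0%R))//; last first.
  move=> t /=; rewrite Fp -[(F t + 2)%R]/(F t + (1 + 1))%R addrA.
  by split=> [/S1/S1//|h]; apply/S1/S1.
have inT x : T x <-> S x /\ (0 <= x < 1)%R by rewrite /T /= in_itv.
have G01 : (G 0 + 1 = G 2)%R by rewrite -Gp add0r.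
rewrite -measureU.
- congr (mu _); apply/seteqP; split=> t /=; rewrite in_itv /= G01.
    move=> [St /andP[h1 h2]].
    have {}h1 : (0 <= F t)%R by rewrite -Gle FK.
    have {}h2 : (F t < 2)%R by rewrite -Gm FK.
    have [h3|h3] := ltP (F t) 1%R; [left|right]; apply/inT.
      by split=> //; rewrite h1.
    split; first by apply/S1; rewrite subrK.
    by rewrite subr_ge0 h3 ltrBlDr.
  move=> [/inT[St /andP[h1 h2]]|/inT[St /andP[h1 h2]]].
    split=> //; rewrite -(FK t) Gle Gm h1 (lt_trans h2)//.
    by rewrite ltr1n.
  split; first by rewrite -(subrK 1%R (F t)); apply/S1.
  rewrite subr_ge0 in h1; rewrite -(FK t) Gle Gm (le_trans ler01)//=.
  by rewrite -ltrBlDr.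
- exact: continuous_preimage_measurable.
- exact: continuous_preimage_measurable.
- apply/seteqP; split=> t //= -[/inT[_ /andP[_ h1]] /inT[_ /andP[h2 _]]].
  by move: h2; rewrite subr_ge0 leNgt h1.
Qed.

Lemma preserves_lebesgueP : preserves_lebesgue f <->
  forall t, (G t + G (t + 1) = t + (G 0 + G 1))%R.
Proof.
split=> [fl|hG A mA]; last first.
  rewrite /pushforward circle_lebesgue_preimage// lebesgue_preimage_add//.
  - by rewrite circle_lebesgueE//; exact: circle_borel_preimage.
  - move=> a b ab; rewrite preimF preimF1.
    rewrite !lebesgue_oc ?Gle ?lerD2r// -EFinD; congr EFin.
    by have := hG a; have := hG b; lra.
  - apply: measurableI; last exact: measurable_itv.
    exact: circle_borel_preimage.
(* As [q] is periodic, it is enough to compare it with [q 0] on the unit interval. *)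
pose q t : R := (G t + G (t + 1) - t)%R.
have qp t : q (t + 1)%R = q t.
  rewrite /q (_ : (t + 1 + 1)%R = (t + 2)%R) ?Gp; ring.
suff q01 t : (0 <= t < 1)%R -> q t = q 0%R.
  move=> t; have [n] := reduce_mod t (ltr01 : 0 < 1 :> R)%R.
  by move=> /q01; rewrite (periodicz qp) /q subr0 add0r; lra.
move=> /andP[]; rewrite le_eqVlt => /predU1P[<-//|t0 t1].
(* Arcs starting at 0 suffice as test sets: the two branches pull them back to intervals whose
   lengths sum to [t], which says [q t = q 0]. *)
pose A : set (circle_borel R) := @ang R @` `]0%R, t[%classic.
have oA : open (A : set (circle R)).
  rewrite openE => _ [u /= + <-]; rewrite in_itv /= => /andP[u0 ut].
  apply/nbhs_ballP; exists (Num.min u (t - u))%R; first by rewrite /= lt_min u0 subr_gt0.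
  move=> y /circle_ballP[v <-]; rewrite lt_min => /andP[h1 h2]; exists v => //=.
  rewrite in_itv /=; move: h1 h2; rewrite !ltr_norml.
  by move=> /andP[a1 a2] /andP[b1 b2]; apply/andP; split; lra.
have mA : measurable A by exact: sub_sigma_algebra.
have TE : @ang R @^-1` A `&` `[0%R, 1%R[%classic = `]0%R, t[%classic.
  apply/seteqP; split=> u /=; rewrite !in_itv /=.
    move=> [[v]]; rewrite /= in_itv /= => /andP[v0 vt] /ang_eq[n un] /andP[u0 u1].
    have n0 : n = 0%R.
      by apply: (@intr_lt1 R); rewrite ltr_norml; apply/andP; split; lra.
    by move: un; rewrite n0 addr0 => ->; rewrite v0.
  move=> /andP[u0 ut]; split; first by exists u => //=; rewrite in_itv /= u0.
  by rewrite (ltW u0) (lt_trans ut).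
have := fl A mA; rewrite /pushforward circle_lebesgue_preimage// TE.
rewrite circle_lebesgueE ?TE; last exact: circle_borel_preimage.
have -> : F @^-1` `]0%R, t[%classic = `]G 0, G t[%classic.
  by apply/seteqP; split=> u /=; rewrite !in_itv /= -(Gm 0%R) -(Gm (F u)) FK.
have -> : (fun t => F t - 1)%R @^-1` `]0%R, t[%classic = `]G 1, G (t + 1)[%classic.
  apply/seteqP; split=> u /=; rewrite !in_itv /=;
  by rewrite subr_gt0 ltrBlDr -(Gm 1%R) -(Gm (F u)) FK.
rewrite !lebesgue_measure_itv /= !lte_fin !Gm t0 -[(1 < t + 1)%R]ltrBlDr subrr t0.
rewrite -!EFinB -EFinD subr0 => -[h]; rewrite /q add0r subr0; move: h; lra.
Qed.

End expanding.
End circle_lebesgue_preserving.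

(** * Expanding maps *)

Section lebesgue_expanding_maps.
Variable R : realType.
Local Notation circle := (circle R).
Local Notation E := (antiperiodic R).
Local Notation Lam := (Lambda_Leb R).
Implicit Types (f g : C1map R) (F G : R -> R) (p s t : R) (u : E).

(** This symmetry turns a change of sign of [u] into the relation that the derivatives of the two
    inverse branches sum to 1. *)
Lemma logisticN (a : R) : logistic (- a) = 1 - logistic a.
Proof.
rewrite /logistic opprK expRN; have h := expR_gt0 a.
have h1 : 1 + expR a != 0 by rewrite gt_eqF// addr_gt0.
have h2 : expR a + 1 != 0 by rewrite addrC.
by field; rewrite ?h1 ?h2 ?gt_eqF.
Qed.

(** Applied to the derivatives at the two preimages of a point: the logarithms of [f' - 1] there are
    opposite. *)
Lemma invr_sum1 (a b : R) : 1 < a -> 1 < b -> a^-1 + b^-1 = 1 ->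
  (a - 1) * (b - 1) = 1.
Proof.
move=> a1 b1 ab; have a0 : a != 0 by rewrite gt_eqF// (lt_trans ltr01).
have b0 : b != 0 by rewrite gt_eqF// (lt_trans ltr01).
have : a * b * (a^-1 + b^-1) = a * b by rewrite ab mulr1.
have -> : a * b * (a^-1 + b^-1) = b + a by field; rewrite a0 b0.
by move=> h; rewrite mulrBl !mulrBr -h; ring.
Qed.

(* [u] is minus the logarithm of [f' - 1], read at the image point and with the
   fixed point [p] as origin; preservation of the Lebesgue measure,
   [1 / f' (x) + 1 / f' (x') = 1] for the two preimages [x], [x'] of a point,
   says that it changes sign under the unit translation. *)
Definition lambda_data f p F u : Prop :=
  [/\ is_lift f F, F p = p, forall t, F (t + 1) = F t + 2
    & forall s, circle_derive f (ang (p + s)) = 1 + expR (- apfun u (F (p + s) - p))].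

Definition lambda_rel (f : Lam) (y : circle * E) : Prop :=
  exists p F, ang p = y.1 /\ lambda_data (\val f) p F y.2.

Lemma lambda_data_derive_gt1 f p F u t : lambda_data f p F u ->
  1 < circle_derive f (ang t).
Proof.
by move=> [_ _ _ fE]; rewrite -[t](subrK p) addrC fE ltrDl expR_gt0.
Qed.

(** Degree 2 sends [p + n] to [p + 2 n], so subtracting [n] from the lift makes [p + n] fixed. *)
Lemma lambda_data_shift f p F u (n : int) : lambda_data f p F u ->
  lambda_data f (p + n%:~R) (fun t => F t - n%:~R) u.
Proof.
move=> [[cF fF] Fp F1 fE].
have Fn (t : R) : F (t + n%:~R) = F t + n%:~R * 2.
  by have := quasiperiodicz (oner_neq0 R) F1 n t; rewrite mulr1.
split.
- split=> t.
    by apply: (@continuousB R R R F (cst _)); [exact: cF|exact: cst_continuous].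
  by rewrite fF -mulrNz angD.
- by rewrite Fn Fp; ring.
- by move=> t; rewrite F1; ring.
- move=> s; have -> : p + n%:~R + s = p + s + n%:~R by ring.
  by rewrite angD fE Fn; congr (1 + expR (- apfun u _)); ring.
Qed.

(** With the fixed point as origin, [u] gives the derivative of the inverse explicitly; the
    derivative of [F] involves [u] at the value of [F] itself. *)
Lemma lambda_data_inverse f p F u : lambda_data f p F u ->
  exists G : R -> R, [/\ forall s, F (p + G s) = p + s,
    forall s, G (F (p + s) - p) = s,
    forall s : R, is_derive s 1 G (logistic (apfun u s)) & forall s, G (s + 2) = G s + 1].
Proof.
move=> fd; have [fF Fp F1 fE] := fd.
have FD := lift_is_derive fF.
have D0 t : 0 < circle_derive f (ang t).
  exact: lt_trans ltr01 (lambda_data_derive_gt1 t fd).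
have [G [FK GK GD Gp]] := quasiperiodic_inverse ltr01 (ltr0Sn R 1) FD D0 F1.
exists (fun s => G (s + p) - p); split=> s.
- by rewrite addrC subrK GK addrC.
- by rewrite subrK FK addrC addKr.
- apply: is_derive1_addr.
  apply: (@is_derive1_translate R G s p).
  have := GD (s + p); rewrite -[G (s + p)](subrK p) [_ - p + p]addrC fE.
  by rewrite [p + (_ - p)]addrC subrK GK addrK.
- by rewrite addrAC Gp; ring.
Qed.

Lemma lambda_data_fun_inj f p F u s : lambda_data f p F u ->
  forall y, F (p + y) = p + s ->
  apfun u s = - ln (circle_derive f (ang (p + y)) - 1).
Proof.
move=> [_ _ _ fE] y yE; rewrite fE yE addrC addKr addrC addKr expRK opprK//.
Qed.

Lemma lambda_rel_total (f : Lam) : exists y, lambda_rel f y.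
Proof.
case: (set_valP f) => f'0 f'1 [F [cF fF F1]] fl.
have FL : is_lift (\val f) F by split.
have FD := lift_is_derive FL.
pose D t := circle_derive (\val f) (ang t).
have Dp t : D (t + 1) = D t by rewrite /D -[t + 1]/(t + 1%:~R) angD.
have cD : continuous D by exact: continuous_derive_ang.
(* The lift minus the identity is increasing of degree 1, hence invertible; the fixed point is its
   preimage of 0. *)
have [p Fp] : exists p, F p = p.
  have HD (t : R) : is_derive t 1 (F - id) (D t - 1).
    by apply: is_deriveB; exact: FD.
  have H0 t : 0 < D t - 1 by rewrite subr_gt0; exact: f'1.
  have H1 t : (F - id) (t + 1) = (F - id) t + 1.
    by rewrite !fctE F1; ring.
  have [K [_ KK _ _]] := quasiperiodic_inverse ltr01 ltr01 HD H0 H1.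
  by exists (K 0); apply/eqP; rewrite -subr_eq0; apply/eqP; exact: (KK 0).
have D0 t : 0 < D t by exact: f'0.
have [G [FK GK GD Gp]] := quasiperiodic_inverse ltr01 (ltr0Sn R 1) FD D0 F1.
have Fm := deriv_gt0_lt FD D0.
have cG : continuous G by move=> t; exact: is_derive1_cont (GD t).
have /preserves_lebesgueP := fl; move=> /(_ G F cF fF FK GK Fm Gp) hG.
(* The measure identity is differentiated on both sides. *)
have Dsum t : (D (G t))^-1 + (D (G (t + 1)))^-1 = 1.
  have G1D (s : R) : is_derive s 1 (fun t => G (t + 1)) (D (G (s + 1)))^-1.
    exact: is_derive1_translate (GD _).
  have h1 : is_derive t 1 (G + fun t => G (t + 1)) ((D (G t))^-1 + (D (G (t + 1)))^-1).
    exact: is_deriveD.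
  have h2 : is_derive t 1 (fun t : R => t + (G 0 + G 1)) (1 : R).
    exact: (@is_derive1_addr R id t _ 1 (is_derive_id _ _)).
  have hE : (G + fun t => G (t + 1)) = (fun t : R => t + (G 0 + G 1)).
    by apply/funext => s; rewrite !fctE hG.
  by rewrite hE in h1; case: h1 => _ <-; case: h2.
pose v s := - ln (D (G (p + s)) - 1).
have cv : continuous v.
  move=> s; apply: (@continuousN R R^o R (fun s => ln (D (G (p + s)) - 1))).
  apply: (@continuous_comp R R R (fun s => D (G (p + s)) - 1) (@ln R)).
    have cDG := continuous_compf cG cD.
    have cp : continuous (fun s : R => p + s).
      by move=> t; apply: (@continuousD R R R (cst p) id) => //; exact: cst_continuous.
    apply: (@continuousB R R R (fun s => D (G (p + s))) (cst 1)).
      exact: (continuous_compf cp cDG).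
    exact: cst_continuous.
  by apply: continuous_ln; rewrite subr_gt0; exact: f'1.
have [s|u uE] := @apfun_ex R v cv.
  have h1 : 0 < D (G (p + s)) - 1 by rewrite subr_gt0; exact: f'1.
  have h2 : 0 < D (G (p + s + 1)) - 1 by rewrite subr_gt0; exact: f'1.
  have : ln (D (G (p + s)) - 1) + ln (D (G (p + s + 1)) - 1) = 0.
    by rewrite -lnM ?posrE// invr_sum1 ?ln1//; exact: f'1.
  by rewrite /v addrA; lra.
exists (ang p, u), p, F; split=> //; split=> // s.
rewrite uE /v [p + (_ - p)]addrC subrK FK opprK lnK.
  by rewrite [RHS]addrC subrK.
by rewrite posrE subr_gt0; exact: f'1.
Qed.

(** The primitive [c] of the logistic function of [u] is the inverse lift centred at the fixed
    point. Antiperiodicity gives [c t + c (t + 1) = t + c 1], which yields both the degree and the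
    preservation of measure. *)
Lemma lambda_rel_onto (y : circle * E) : exists f : Lam, lambda_rel f y.
Proof.
case: y => x u; have [p px] := ang_surj x.
pose g t := logistic (apfun u t).
have cg : continuous g by exact: continuous_compf (@apfun_cont _ u) (@logistic_cont R).
have g0 t : 0 < g t by exact: logistic_gt0.
have g1 t : g t + g (t + 1) = 1 by rewrite /g apfunD1 logisticN; ring.
have [c c0 cD] := continuous_primitive cg.
have c1 t : c t + c (t + 1) = t + c 1.
  have P1D (s' : R) : is_derive s' 1 (fun t => c (t + 1)) (g (s' + 1)).
    exact: is_derive1_translate (cD _).
  have h (s' : R) : is_derive s' 1 (c + (fun t => c (t + 1)) - id) 0.
    rewrite [X in is_derive _ _ _ X](_ : 0 = g s' + g (s' + 1) - 1); last by rewrite g1 subrr.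
    exact: (is_deriveB (is_deriveD (cD s') (P1D s')) (is_derive_id _ _)).
  have hh : c t + c (t + 1) - t = c 0 + c (0 + 1) - 0 by exact: is_derive_0_is_cst t 0 h.
  by move: hh; rewrite add0r c0; lra.
have c2 t : c (t + 2) = c t + 1.
  have := c1 t; have := c1 (t + 1).
  by rewrite (_ : t + 1 + 1 = t + 2); [lra|ring].
have [phi [cK phiK phiD phi1]] := quasiperiodic_inverse (ltr0Sn R 1) ltr01 cD g0 c2.
have cphi : continuous phi by move=> t; exact: is_derive1_cont (phiD t).
pose D t := (g (phi (t - p)))^-1; pose F t := phi (t - p) + p.
have FD (t : R) : is_derive t 1 F (D t).
  apply: is_derive1_addr; apply: (@is_derive1_translate R phi t (- p)); exact: phiD.
have csub : continuous (fun t : R => t - p).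
  by move=> t; apply: (@continuousB R R R id (cst p)) => //; exact: cst_continuous.
have Cphi := continuous_compf csub cphi.
have cDD : continuous D.
  move=> t; apply: (@continuousV R R (fun t => g (phi (t - p)))); first by rewrite gt_eqF.
  exact: (continuous_compf Cphi cg).
have F1 t : F (t + 1) = F t + 2 by rewrite /F addrAC phi1; ring.
have D1 t : D (t + 1) = D t.
  by rewrite /D addrAC phi1 /g apfunD2.
have [f [fF f'E]] := @C1map_of_lift R F D 2 cDD FD F1 D1.
have f'1 t : 1 < circle_derive f (ang t).
  by rewrite f'E invf_gt1//; exact: logistic_lt1.
have fP : f \in Lambda_Leb R.
  rewrite inE; split.
  - by move=> z; have [t <-] := ang_surj z; exact: lt_trans ltr01 (f'1 t).
  - by move=> z; have [t <-] := ang_surj z; exact: f'1.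
  - by exists F; case: fF.
  apply/(@preserves_lebesgueP R f F (fun t => c (t - p) + p)).
  - by case: fF.
  - by case: fF.
  - by move=> t; rewrite /F addrK phiK subrK.
  - by move=> t; rewrite /F addrK cK subrK.
  - by apply: deriv_gt0_lt FD _ => t; rewrite /D invr_gt0.
  - by move=> t; rewrite addrAC c2; ring.
  move=> t; have := c1 (t - p); have := c1 (0 - p).
  rewrite [t + 1 - p]addrAC [1 - p]addrC sub0r; lra.
exists (SigSub fP), p, F; split=> //; split=> // [|s].
  by rewrite /F subrr -{1}c0 cK add0r.
rewrite f'E /D /F /g /logistic invrK addrK.
by rewrite [p + s]addrC addrK.
Qed.

End lebesgue_expanding_maps.

Section lebesgue_expanding_homeomorphism.
Variable R : realType.
Local Notation circle := (circle R).
Local Notation E := (antiperiodic R).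
Local Notation Lam := (Lambda_Leb R).
Implicit Types (f g : C1map R) (F G : R -> R) (p s t : R) (u : E).

Lemma logistic_ratio (a b : R) :
  `|logistic a - logistic b| <= `|expR (b - a) - 1|.
Proof.
have h (x : R) : 0 < 1 + expR (- x) by rewrite addr_gt0// expR_gt0.
(* The first two factors lie between 0 and 1, so the bound is uniform in [a] and [b]. *)
have -> : logistic a - logistic b =
    logistic a * (expR (- b) * logistic b) * (1 - expR (b - a)).
  rewrite /logistic expRD -[expR b](invrK) -expRN.
  by field; rewrite !gt_eqF ?expR_gt0 ?h.
rewrite normrM distrC -[leRHS]mul1r ler_wpM2r// ger0_norm; last first.
  by rewrite !mulr_ge0 ?expR_ge0 ?ltW ?logistic_gt0.
rewrite mulr_ile1 ?ltW ?logistic_lt1 ?logistic_gt0 ?mulr_ge0 ?expR_ge0//.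
  by rewrite mulr_gt0 ?expR_gt0 ?logistic_gt0.
by rewrite ltr_pdivrMr ?h// mul1r ltrDr.
Qed.

(** Closeness on the circle bounds the difference of the lifts only up to an integer depending on
    the point. Since [d <= 1/2] this integer is constant, and a shift of the data absorbs it. *)
Lemma lambda_data_align f g p q F G u (w : E) (d : R) :
  d <= 2^-1 -> C1_close d f g -> lambda_data f p F u -> lambda_data g q G w ->
  exists q' G', [/\ ang q' = ang q, lambda_data g q' G' w
    & forall t, `|F t - G' t| < d].
Proof.
move=> d2 [fg _] fd gd; have [[cF fF] _ _ _] := fd; have [[cG gG] _ _ _] := gd.
have cD : continuous (fun t => G t - F t).
  by move=> t; apply: (@continuousB R R R); [exact: cG|exact: cF].
have [t|n hn] := near_integer_const cD d2.
  have := fg (ang t); rewrite fF gG => /circle_ballP[v /esym/ang_eq[k ->]] h.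
  exists (- k); have -> : G t - F t - (- k)%:~R = - (F t - (G t + k%:~R)).
    by rewrite mulrNz; ring.
  by rewrite normrN.
exists (q + n%:~R), (fun t => G t - n%:~R); split.
- exact: angD.
- exact: lambda_data_shift.
- move=> t; have -> : F t - (G t - n%:~R) = - (G t - F t - n%:~R) by ring.
  by rewrite normrN.
Qed.

Lemma lambda_rel_continuous (f : Lam) (y : circle * E) : lambda_rel f y ->
  forall V, nbhs y V -> \forall g \near f, forall y', lambda_rel g y' -> V y'.
Proof.
case: y => x u [p [F [px fd]]] V /nbhs_circle_apP[e e0 eV].
rewrite /= in px fd eV.
pose D t := circle_derive (\val f) (ang t).
have cD : continuous D by exact: continuous_derive_ang.
have Dp t : D (t + 1) = D t by rewrite /D -[t + 1]/(t + 1%:~R) angD.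
have D1 t : 1 < D t by exact: lambda_data_derive_gt1 fd.
have [m m0 hm] : exists2 m : R, 0 < m & forall t, m <= D t - 1.
  apply: (@periodic_pos_lb R _ 1 ltr01).
  - by move=> t; rewrite Dp.
  - by move=> t; apply: (@continuousB R R R D (cst 1)); [exact: cD|exact: cst_continuous].
  - by move=> t; rewrite subr_gt0.
have [eta eta0 heta] := ln_unif_cont m0 e0.
have eta2 : 0 < eta / 2 by exact: divr_gt0.
have [d1 d10 hd1] := periodic_unif_cont ltr01 Dp cD eta2.
have c0 : 0 < m^-1 + 1 by rewrite addr_gt0 ?invr_gt0.
(* In order: the alignment of lifts, [d / m <= e] for the fixed points, the derivatives of [f] and
   [g] at one point, and [d / m + d <= d1] for the two preimages compared below. *)
pose d := Num.min (Num.min 2^-1 (m * e)) (Num.min (eta / 2) (d1 / (m^-1 + 1))).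
have d0 : 0 < d by rewrite !lt_min invr_gt0 ltr0n mulr_gt0// eta2 divr_gt0.
have [da db dc dd] : [/\ d <= 2^-1, d <= m * e, d <= eta / 2 & d <= d1 / (m^-1 + 1)].
  by rewrite /d !ge_min !lexx ?orbT.
apply/nbhs_C1_subP; exists d => // g fg [x1 w] [q0 [G0 [/= qx gd0]]].
have [q [G [qE gd FG]]] := lambda_data_align da fg fd gd0.
have [fF Fp F1 fE] := fd; have [gG Gq G1 gE] := gd.
have FD := lift_is_derive fF.
(* The lift [F] minus the identity has slope at least [m] and vanishes at [p]; at [q] it equals
   [F q - G q], which is smaller than [d]. *)
have pq : `|p - q| < d / m.
  rewrite ltr_pdivlMr//; have HD (t : R) : is_derive t 1 (F - id) (D t - 1).
    exact: (is_deriveB (FD t) (is_derive_id _ _)).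
  have [c] := MVT_exists q p HD; rewrite !fctE Fp subrr sub0r opprB => h.
  apply: le_lt_trans (FG q); rewrite Gq [leRHS]distrC h normrM mulrC.
  by rewrite ler_wpM2r// (le_trans (hm c))// ler_norm.
apply: eV => /= [|s].
  rewrite -px -qx -qE; apply: circle_ball_ang; apply: (lt_le_trans pq).
  by rewrite ler_pdivrMr// mulrC.
have [A [FA _ _ _]] := lambda_data_inverse fd.
have [B [GB _ _ _]] := lambda_data_inverse gd.
rewrite (lambda_data_fun_inj fd (FA s)) (lambda_data_fun_inj gd (GB s)).
set a := p + A s; set b := q + B s.
(* Expansion bounds the distance of the preimages by that of their images under [F]. *)
have ab : `|a - b| < d1.
  have h1 : `|a - b| <= `|F a - F b|.
    have [c ->] := MVT_exists b a FD; rewrite normrM ler_peMl//.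
    by rewrite (le_trans (ltW (D1 c)))// ler_norm.
  apply: (le_lt_trans h1).
  have -> : F a - F b = (p - q) - (F b - G b) by rewrite /a /b FA GB; ring.
  apply: (@lt_le_trans _ _ (d / m + d)).
    by rewrite (le_lt_trans (ler_normB _ _))// ltrD.
  by rewrite -[X in _ + X]mulr1 -mulrDr -ler_pdivlMr.
rewrite -opprD normrN; have [|_] := heta (D a - 1) (circle_derive (\val g) (ang b) - 1) (hm a).
  have -> : D a - 1 - (circle_derive (\val g) (ang b) - 1) =
    (D a - D b) + (D b - circle_derive (\val g) (ang b)) by ring.
  rewrite (le_lt_trans (ler_normD _ _))// [eta]splitr ltrD//; first exact: hd1.
  by rewrite (lt_le_trans (fg.2 (ang b))).
by [].
Qed.

Lemma lambda_rel_continuousV (f : Lam) (y : circle * E) : lambda_rel f y ->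
  forall U, nbhs f U -> \forall y' \near y, forall g : Lam, lambda_rel g y' -> U g.
Proof.
case: y => x u [p [F [px fd]]] U /nbhs_C1_subP[b b0 bU]; rewrite /= in px fd.
have [fF Fp F1 fE] := fd; have FD := lift_is_derive fF.
pose D t := circle_derive (\val f) (ang t).
have cD : continuous D by exact: continuous_derive_ang.
have Dp t : D (t + 1) = D t by rewrite /D -[t + 1]/(t + 1%:~R) angD.
have [B B0 hB] := periodic_bounded ltr01 Dp cD.
pose K t := expR (- apfun u t).
have cK : continuous K.
  have cN : continuous (fun t => - apfun u t).
    by move=> t; apply: (@continuousN R R^o R); exact: apfun_cont.
  exact: (continuous_compf cN (@continuous_expR R)).
have Kp t : K (t + 2) = K t by rewrite /K apfunD2.
have [C C0 hC] := periodic_bounded (ltr0Sn R 1) Kp cK.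
have b2 : 0 < b / 2 by exact: divr_gt0.
have [d3 d30 hd3] := periodic_unif_cont (ltr0Sn R 1) Kp cK b2.
pose e := Num.min b d3.
have e0 : 0 < e by rewrite lt_min b0.
(* The first bound controls the inverse lifts, [B] being a Lipschitz constant of [F]; the second
   controls the derivatives, [C] being a bound of [f' - 1]. *)
have e4 : 0 < Num.min (e / (4 * B)) (b / 2 / C) by rewrite lt_min !divr_gt0// mulr_gt0.
have [d4 d40 hd4] := expR_near0 e4.
pose d := Num.min d4 (Num.min (e / 4) (e / (4 * B))).
have d0 : 0 < d by rewrite !lt_min d40 !divr_gt0// mulr_gt0.
have [da db dc] : [/\ d <= d4, d <= e / 4 & d <= e / (4 * B)].
  by rewrite /d !ge_min !lexx ?orbT.
apply/nbhs_circle_apP; exists d => // -[x1 w] /= xx1 uw g [q0 [G0 [/= qx gd0]]].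
apply: bU.
have [q [G [gd pq]]] : exists q G, lambda_data (\val g) q G w /\ `|p - q| < d.
  move: xx1; rewrite -px => /circle_ballP[q]; rewrite -qx => /esym/ang_eq[n ->] h.
  by exists (q0 + n%:~R), (fun t => G0 t - n%:~R); split=> //; exact: lambda_data_shift.
have [gG Gq G1 gE] := gd.
have [S [FS SF SD S2]] := lambda_data_inverse fd.
have [T [GT TG TD T2]] := lambda_data_inverse gd.
have S0 : S 0 = 0 by have := SF 0; rewrite addr0 Fp subrr.
have T0 : T 0 = 0 by have := TG 0; rewrite addr0 Gq subrr.
have uw' t : `|apfun u t - apfun w t| < d4 by exact: lt_le_trans (uw t) da.
have [hB' hC'] : (forall t, `|expR (apfun u t - apfun w t) - 1| < e / (4 * B)) /\
    (forall t, `|expR (apfun u t - apfun w t) - 1| < b / 2 / C).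
  by split=> t; have := hd4 _ (uw' t); rewrite lt_min => /andP[].
(* The inverses agree at 0 and their difference has period 2, so the derivative bound is integrated
   over a length of at most 2. *)
have ST s : `|S s - T s| <= 2 * (e / (4 * B)).
  have [n /andP[n0 n2]] := reduce_mod s (ltr0Sn R 1 : 0 < 2 :> R).
  have STp t : S (t + 2) - T (t + 2) = S t - T t by rewrite S2 T2; ring.
  rewrite -(@periodicz R (fun t => S t - T t) 2 STp n s).
  set r := s + _ in n0 n2 *.
  have HD (t : R) : is_derive t 1 (S - T) (logistic (apfun u t) - logistic (apfun w t)).
    exact: (is_deriveB (SD t) (TD t)).
  have [c] := MVT_exists 0 r HD; rewrite !fctE S0 T0 !subr0 => ->.
  rewrite normrM mulrC ler_pM// ?(ger0_norm n0) ?(ltW n2)//.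
  by rewrite distrC (le_trans (logistic_ratio _ _))// ltW.
have FL (a c : R) : `|F a - F c| <= B * `|a - c|.
  by have [z ->] := MVT_exists c a FD; rewrite normrM ler_wpM2r// hB.
(* Writing [t] as [q + T s] turns the gap into a difference of two values of [F]. The distance
   [p - q] contributes one quarter of [e] and [S s - T s] two quarters. *)
have FG t : `|F t - p - (G t - q)| < e * (3 / 4).
  pose s := G t - q.
  have tE : t = q + T s by rewrite /s -[t in G t](subrK q) [t - q + q]addrC TG addrC subrK.
  have -> : F t - p - (G t - q) = (F (q + T s) - F (p + S s)).
    by rewrite FS -tE /s; ring.
  apply: (le_lt_trans (FL _ _)).
  have -> : q + T s - (p + S s) = - ((p - q) + (S s - T s)) by ring.
  rewrite normrN; have -> : e * (3 / 4) = B * (e / (4 * B) + 2 * (e / (4 * B))).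
    by field; rewrite gt_eqF.
  rewrite ltr_pM2l// (le_lt_trans (ler_normD _ _))// ltr_leD//.
  exact: lt_le_trans pq dc.
split=> z; have [t <-] := ang_surj z.
  rewrite fF.2 gG.2; apply: circle_ball_ang; apply: (@lt_le_trans _ _ e); last first.
    by rewrite ge_min lexx.
  have -> : F t - G t = (p - q) + (F t - p - (G t - q)) by ring.
  have -> : e = e / 4 + e * (3 / 4) by field.
  by rewrite (le_lt_trans (ler_normD _ _))// ltrD// (lt_le_trans pq).
rewrite -{1}[t](subrK p) -{2}[t](subrK q) [t - p + p]addrC [t - q + q]addrC fE gE.
rewrite [p + _]addrC [q + _]addrC !subrK.
set a := F t - p; set c := G t - q.
(* The first difference comes from reading [u] at two nearby points, the second from replacing [u]
   by [w] at one point. *)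
have -> : 1 + expR (- apfun u a) - (1 + expR (- apfun w c)) =
  (K a - K c) - K c * (expR (apfun u c - apfun w c) - 1).
  by rewrite /K mulrBr -expRD mulr1 addrA addNr add0r; ring.
rewrite (le_lt_trans (ler_normB _ _))// [b]splitr ltrD//.
  apply: hd3; apply: (lt_le_trans (FG t)).
  apply: (@le_trans _ _ e); last by rewrite ge_min lexx orbT.
  by rewrite ler_piMr ?ltW//; lra.
rewrite normrM (le_lt_trans (ler_wpM2r (normr_ge0 _) (hC c)))//.
by rewrite mulrC -ltr_pdivlMr.
Qed.

Lemma lambda_homeomorphic : homeomorphic Lam (circle * E)%type.
Proof.
apply: (@homeomorphic_of_rel _ _ (@lambda_rel R)).
- exact: lambda_rel_total.
- exact: lambda_rel_onto.
- exact: C1_sub_nbhs_separated.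
- apply: hausdorff_nbhs_separated; apply: prod_hausdorff.
    exact: circle_hausdorff.
  exact: ap_hausdorff.
- exact: lambda_rel_continuous.
- exact: lambda_rel_continuousV.
Qed.

End lebesgue_expanding_homeomorphism.

Theorem theorem1p1 (R : realType) :
  [/\ homeomorphic (Lambda_Leb R) (torus_minus_diag R * Diff0 R)%type,
      arc_connected R (Lambda_Leb R)
    & forall f : Lambda_Leb R, pi1_iso_int R f].
Proof.
have hL := @lambda_homeomorphic R; have [h [k [hK kK ch ck]]] := hL.
split.
- exact: homeomorphic_trans hL (homeomorphic_sym (@torus_diffeos_homeomorphic R)).
- exact: (arc_connected_circle_times_convex hK kK ch ck (@ap_conv_cont R)
    (@ap_conv0 R) (@ap_conv1 R) (@ap_conv_inj R) (@ap_hausdorff R)).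
- exact: (pi1_circle_times_convex hK kK ch ck (@ap_conv_cont R)
    (@ap_conv0 R) (@ap_conv1 R) (@ap_convxx R)).
Qed.
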